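(* Suppose that $v$ satisfies Assumption A (stated in the context) on the compact rectangle $T$. Then the following hold. (i) For any fixed $x_0\in T$, there exists a constant $0\le\kappa_1\le\infty$, which may depend on $x_0$, such that $$\liminf_{r\to0+}\ \sup_{x\in T:\,\Delta(x,x_0)\le r}\frac{|v(x)-v(x_0)|}{r(\log\log(1/r))^{-1/Q}}=\kappa_1\quad\text{a.s.}$$ (ii) For any fixed $x_0\in T$, there exists a constant $0\le\kappa_2\le\infty$, which may depend on $x_0$, such that $$\lim_{r\to0+}\ \sup_{x\in T:\,0<\Delta(x,x_0)\le r}\frac{|v(x)-v(x_0)|}{\Delta(x,x_0)\sqrt{\log\log(\Delta(x,x_0)^{-1})}}=\kappa_2\quad\text{a.s.}$$ (iii) There exists a constant $0\le\kappa_3\le\infty$ such that $$\lim_{r\to0+}\ \sup_{x,y\in T:\,0<\Delta(x,y)\le r}\frac{|v(x)-v(y)|}{\Delta(x,y)\sqrt{\log(\Delta(x,y)^{-1})}}=\kappa_3\quad\text{a.s.}$$ Moreover, if $v$ satisfies both Assumption A and Assumption C (stated in the context), then (ii) and (iii) also hold with $\Delta$ replaced everywhere by the canonical metric $d$, with possibly different constants in $[0,\infty]$.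
   Context: Let $k\ge1$, let $v=\{v(x):x\in\mathbb R^k\}$ be a real-valued continuous centered Gaussian random field, and let $T\subset\mathbb R^k$ be a compact rectangle (a product of compact intervals of positive length). Write $\|X\|_{L^2}=(\mathbb E[X^2])^{1/2}$. Assumption A. There exists a centered Gaussian random field $\{v(A,x):A\in\mathscr B(\mathbb R_+),x\in T\}$, where $\mathscr B(\mathbb R_+)$ is the Borel $\sigma$-algebra of $\mathbb R_+=[0,\infty)$, such that: (a) for every $x\in T$, $A\mapsto v(A,x)$ is an independently scattered Gaussian noise (values on disjoint sets are independent, and $v(\bigcup_nA_n,x)=\sum_nv(A_n,x)$ in $L^2$ for disjoint $A_n$) with $v(\mathbb R_+,x)=v(x)$, and the processes $v(A,\cdot)$ and $v(B,\cdot)$ are independent whenever $A$ and $B$ are disjoint; (b) there exist constants $c_0>0$, $a_0\ge0$ and $\gamma_j>0$, $j=1,\dots,k$, such that for all $a_0\le a<b\le\infty$ and $x,y\in T$ (with $b^{-1}=0$ if $b=\infty$), $$\|v([a,b),x)-v(x)-v([a,b),y)+v(y)\|_{L^2}\le c_0\Big(\sum_{j=1}^ka^{\gamma_j}|x_j-y_j|+b^{-1}\Big)$$ and $$\|v([0,a_0),x)-v([0,a_0),y)\|_{L^2}\le c_0\sum_{j=1}^k|x_j-y_j|.$$ Notation: $\alpha_j=(\gamma_j+1)^{-1}\in(0,1)$, $Q=\sum_{j=1}^k\alpha_j^{-1}$, $\Delta(x,y)=\sum_{j=1}^k|x_j-y_j|^{\alpha_j}$ and $d(x,y)=\|v(x)-v(y)\|_{L^2}$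 for $x,y\in\mathbb R^k$. Assumption C. There exists a constant $c_3>0$ such that $\|v(x)-v(y)\|_{L^2}\ge c_3\Delta(x,y)$ for all $x,y\in T$. *)

(* Defs.v *)
From HB Require Import structures.
From mathcomp Require Export all_boot all_order all_algebra.
From mathcomp Require Export all_classical all_reals all_analysis.

Set Implicit Arguments.
Unset Strict Implicit.
Unset Printing Implicit Defensive.
Import Order.TTheory GRing.Theory Num.Theory.
Import numFieldNormedType.Exports.

Local Open Scope classical_set_scope.
Local Open Scope ring_scope.

(* [normal_prob 0 0] is the uniform law on [0, 1] by the library's convention,
   so the degenerate centered Gaussian law is given separately. *)
Definition centered_gaussian_law (R : realType) (s : R) (B : set R) : \bar R :=
  if s == 0 then \d_(0 : R) B else normal_prob 0 s B.

Definition centered_gaussian (dsp : measure_display) (Omega : measurableType dsp)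
    (R : realType) (P : probability Omega R) (X : Omega -> R) : Prop :=
  exists2 s : R, 0 <= s &
    forall B : set R, measurable B -> P (X @^-1` B) = centered_gaussian_law s B.

(* [D] is the actual index set; the values of [X] outside [D] are irrelevant. *)
Definition centered_gaussian_field (dsp : measure_display)
    (Omega : measurableType dsp) (R : realType) (P : probability Omega R)
    (I : Type) (D : set I) (X : I -> {RV P >-> R}) : Prop :=
  forall (n : nat) (t : 'I_n -> I) (c : 'I_n -> R), (forall i, D (t i)) ->
    centered_gaussian P (fun w => \sum_(i < n) c i * X (t i) w).

Definition L2norm (dsp : measure_display) (Omega : measurableType dsp)
    (R : realType) (P : probability Omega R) (X : Omega -> R) : \bar R :=
  ('N[P]_2%:E[EFin \o X])%E.

(* The product rule for subfamilies is the case [B i = setT] for some [i]. *)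
Definition mutually_independent (dsp : measure_display)
    (Omega : measurableType dsp) (R : realType) (P : probability Omega R)
    (n : nat) (X : 'I_n -> {RV P >-> R}) : Prop :=
  forall B : 'I_n -> set R, (forall i, measurable (B i)) ->
    P (\bigcap_(i in [set: 'I_n]) (X i @^-1` B i)) =
    (\prod_(i < n) P (X i @^-1` B i))%E.

Definition generated_sigma_algebra (dsp : measure_display)
    (Omega : measurableType dsp) (R : realType) (P : probability Omega R)
    (I : Type) (D : set I) (X : I -> {RV P >-> R}) : set (set Omega) :=
  <<s [set E | exists i (B : set R), [/\ D i, measurable B & E = X i @^-1` B]] >>.

Definition independent_processes (dsp : measure_display)
    (Omega : measurableType dsp) (R : realType) (P : probability Omega R)
    (I : Type) (D : set I) (X Y : I -> {RV P >-> R}) : Prop :=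
  forall E F : set Omega,
    generated_sigma_algebra D X E -> generated_sigma_algebra D Y F ->
    P (E `&` F) = (P E * P F)%E.

Definition rectangle (R : realType) (k : nat) (lo hi : 'rV[R]_k) :
    set 'rV[R]_k :=
  [set x | forall j, lo 0 j <= x 0 j <= hi 0 j].

Definition nonneg (R : realType) : set R := [set t | 0 <= t].

Definition borel_nonneg (R : realType) : set (set R) :=
  [set A | measurable A /\ A `<=` @nonneg R].

(* the interval [a, b) of real numbers, where b may be +oo *)
Definition ico (R : realType) (a : R) (b : \bar R) : set R :=
  [set t | a <= t /\ (t%:E < b)%E].

Definition independently_scattered (dsp : measure_display)
    (Omega : measurableType dsp) (R : realType) (P : probability Omega R)
    (W : set R -> {RV P >-> R}) : Prop :=
  (forall (n : nat) (A : 'I_n -> set R),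
     (forall i, borel_nonneg (A i)) -> trivIset setT A ->
     mutually_independent (fun i => W (A i))) /\
  (forall A : nat -> set R,
     (forall i, borel_nonneg (A i)) -> trivIset setT A ->
     L2norm P (fun w => W (\bigcup_i A i) w - \sum_(i < n) W (A i) w)
       @[n --> \oo] --> 0%E).

(* [W A x] stands for v(A, x); only Borel subsets [A] of the half-line and
   points [x] of [T] matter.
   In the bound for [a, b), [b^-1] is the inverse of the extended reals, so it
   is 0 for b = +oo; b is never 0 since 0 <= a < b. *)
Definition assumptionA (dsp : measure_display) (Omega : measurableType dsp)
    (R : realType) (P : probability Omega R) (k : nat)
    (v : 'rV[R]_k -> {RV P >-> R}) (T : set 'rV[R]_k) (gamma : 'I_k -> R) :
    Prop :=
  exists W : set R -> 'rV[R]_k -> {RV P >-> R},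
    centered_gaussian_field [set p : set R * 'rV[R]_k | borel_nonneg p.1 /\ T p.2]
      (fun p => W p.1 p.2) /\
    [/\ forall x, T x -> independently_scattered (fun A => W A x),
        forall x, T x -> {ae P, forall w, W (@nonneg R) x w = v x w} &
        forall A B, borel_nonneg A -> borel_nonneg B -> A `&` B = set0 ->
          independent_processes T (W A) (W B)] /\
    exists c0 a0 : R,
      [/\ 0 < c0, 0 <= a0, forall j, 0 < gamma j,
        forall (a : R) (b : \bar R) (x y : 'rV[R]_k),
          a0 <= a -> (a%:E < b)%E -> T x -> T y ->
          (L2norm P (fun w => (W (ico a b) x w - v x w
                                - W (ico a b) y w + v y w)%R)
           <= c0%:E * ((\sum_(j < k) a `^ gamma j * `|x 0 j - y 0 j|)%R%:E
                       + b^-1))%E &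
        forall x y : 'rV[R]_k, T x -> T y ->
          (L2norm P (fun w => (W (ico 0 a0%:E) x w - W (ico 0 a0%:E) y w)%R)
           <= (c0 * \sum_(j < k) `|x 0 j - y 0 j|)%R%:E)%E].

Definition alpha (R : realType) (k : nat) (gamma : 'I_k -> R) (j : 'I_k) : R :=
  (gamma j + 1)^-1.

Definition Qdim (R : realType) (k : nat) (gamma : 'I_k -> R) : R :=
  \sum_(j < k) (alpha gamma j)^-1.

Definition Delta (R : realType) (k : nat) (gamma : 'I_k -> R)
    (x y : 'rV[R]_k) : R :=
  \sum_(j < k) `|x 0 j - y 0 j| `^ alpha gamma j.

(* [fine] loses nothing here: Gaussian variables have finite second moment. *)
Definition canonical_metric (dsp : measure_display)
    (Omega : measurableType dsp) (R : realType) (P : probability Omega R)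
    (k : nat) (v : 'rV[R]_k -> {RV P >-> R}) (x y : 'rV[R]_k) : R :=
  fine (L2norm P (fun w => v x w - v y w)).

Definition assumptionC (dsp : measure_display) (Omega : measurableType dsp)
    (R : realType) (P : probability Omega R) (k : nat)
    (v : 'rV[R]_k -> {RV P >-> R}) (T : set 'rV[R]_k) (gamma : 'I_k -> R) :
    Prop :=
  exists2 c3 : R, 0 < c3 & forall x y, T x -> T y ->
    ((c3 * Delta gamma x y)%:E <= L2norm P (fun w => (v x w - v y w)%R))%E.

Definition chung_ratio_sup (R : realType) (k : nat) (gamma : 'I_k -> R)
    (T : set 'rV[R]_k) (f : 'rV[R]_k -> R) (x0 : 'rV[R]_k) (r : R) : \bar R :=
  ereal_sup [set (`|f x - f x0|
                   / (r * ln (ln r^-1) `^ (- (Qdim gamma)^-1)))%:E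
            | x in [set x | T x /\ Delta gamma x x0 <= r]].

Definition local_modulus_sup (R : realType) (k : nat)
    (m : 'rV[R]_k -> 'rV[R]_k -> R)
    (T : set 'rV[R]_k) (f : 'rV[R]_k -> R) (x0 : 'rV[R]_k) (r : R) : \bar R :=
  ereal_sup [set (`|f x - f x0|
                   / (m x x0 * Num.sqrt (ln (ln (m x x0)^-1))))%:E
            | x in [set x | T x /\ 0 < m x x0 <= r]].

Definition uniform_modulus_sup (R : realType) (k : nat)
    (m : 'rV[R]_k -> 'rV[R]_k -> R)
    (T : set 'rV[R]_k) (f : 'rV[R]_k -> R) (r : R) : \bar R :=
  ereal_sup [set (`|f p.1 - f p.2|
                   / (m p.1 p.2 * Num.sqrt (ln (m p.1 p.2)^-1)))%:E
            | p in [set p : 'rV[R]_k * 'rV[R]_k |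
                    [/\ T p.1, T p.2 & 0 < m p.1 p.2 <= r]]].

Definition chung_lil (dsp : measure_display) (Omega : measurableType dsp)
    (R : realType) (P : probability Omega R) (k : nat)
    (v : 'rV[R]_k -> {RV P >-> R}) (T : set 'rV[R]_k) (gamma : 'I_k -> R) :
    Prop :=
  forall x0, T x0 -> exists2 kappa : \bar R, (0 <= kappa)%E &
    {ae P, forall w,
      limf_einf (chung_ratio_sup gamma T (fun x => v x w) x0) 0^'+ = kappa}.

Definition local_modulus (dsp : measure_display) (Omega : measurableType dsp)
    (R : realType) (P : probability Omega R) (k : nat)
    (v : 'rV[R]_k -> {RV P >-> R}) (T : set 'rV[R]_k)
    (m : 'rV[R]_k -> 'rV[R]_k -> R) : Prop :=
  forall x0, T x0 -> exists2 kappa : \bar R, (0 <= kappa)%E &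
    {ae P, forall w,
      local_modulus_sup m T (fun x => v x w) x0 r @[r --> 0^'+] --> kappa}.

Definition uniform_modulus (dsp : measure_display) (Omega : measurableType dsp)
    (R : realType) (P : probability Omega R) (k : nat)
    (v : 'rV[R]_k -> {RV P >-> R}) (T : set 'rV[R]_k)
    (m : 'rV[R]_k -> 'rV[R]_k -> R) : Prop :=
  exists2 kappa : \bar R, (0 <= kappa)%E &
    {ae P, forall w,
      uniform_modulus_sup m T (fun x => v x w) r @[r --> 0^'+] --> kappa}.

(* Main.v *)
Require Import Defs.
From mathcomp Require Import measurable_realfun ring lra.

(** Each of the limits in question is a functional of the sample path at
    arbitrarily small scales. The proof shows that such a functional does not
    depend on any bounded band of frequencies of the field, and that a
    functional of this kind is almost surely constant.

    Split the field at frequency [n] into v([0, n), x) and v([n, oo), x). By the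
    bound on bands, the low part is Lipschitz in L2 for the l1 distance on the
    rectangle. Chaining along dyadic nets with Gaussian tails
    ([chaining_hoelder]) gives Hoelder increments of every exponent below one
    on the countable set of net points. Since the exponents 1 / alpha_j exceed
    one, the l1 distance is at most a power larger than one of Delta
    ([l1dist_le_Delta]), so the increments of the low part are negligible
    against every gauge at small scales ([locally_hoelder_gain],
    [powR_le_linear], [powR_le_chung_gauge]). Hence the limits are the same
    along the field and along its high part.

    The limits are first expressed through the net points ([net_modulus_cvg],
    [net_chungE]): the sample paths of the field are continuous, so nothing is
    lost; the functionals become measurable on the path space, and they make
    sense for the paths of the low and high parts as well.

    The zero-one law ([zero_one_law]) is proved directly. An event E on the
    field that is also an event on every high part is independent of every
    low part. The low parts converge to the field in probability, so E is
    independent of the field, and therefore of itself.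

    For the canonical metric, the lower bound by Delta gives the same control
    of the l1 distance, and the two bounds on bands give its continuity
    ([field_L2_le]), which the reduction to net points requires. *)

Set Implicit Arguments.
Unset Strict Implicit.
Unset Printing Implicit Defensive.
Import Order.TTheory GRing.Theory Num.Theory.
Import numFieldNormedType.Exports.
Local Open Scope classical_set_scope.
Local Open Scope ring_scope.

(** * The path space of a random field *)

(** Finite intersections of half-spaces, closed on the left as in a standard
    generator of the Borel sets of the line: a pi-system that makes all
    evaluations at points of [D] measurable. *)
Definition upper_boxes (I : choiceType) (R : realType) (D : set I) :
    set (set (I -> R)) :=
  [set E | exists2 s : seq (I * R), (forall p, p \in s -> D p.1) &
           E = [set f | forall p, p \in s -> p.2 <= f p.1]].

(** Paths are functions on all of [I], but only their values on [D] are
    observable; this avoids restrictions to a subtype. *)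
Definition path_space (I : choiceType) (R : realType) (D : set I) :=
  g_sigma_algebraType (@upper_boxes I R D).

Lemma setI_closed_upper_boxes (I : choiceType) (R : realType) (D : set I) :
  setI_closed (@upper_boxes I R D).
Proof.
move=> A B [s sD ->] [t tD ->]; exists (s ++ t).
  by move=> p; rewrite mem_cat => /orP[/sD|/tD].
apply/seteqP; split=> f /=.
  by move=> [fs ft] p; rewrite mem_cat => /orP[/fs|/ft].
by move=> fst; split=> p ps; apply: fst; rewrite mem_cat ps ?orbT.
Qed.

Lemma measurable_eval (I : choiceType) (R : realType) (D : set I) (i : I) :
  D i -> measurable_fun [set: path_space R D] (fun f : path_space R D => f i).
Proof.
move=> Di; apply: (measurability (@RGenCInfty.G R)).
  exact: RGenCInfty.measurableE.
move=> _ [_ [x ->] <-]; rewrite setTI; apply: sub_sigma_algebra.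
exists [:: (i, x)]; first by move=> p; rewrite inE => /eqP ->.
apply/seteqP; split=> f /=; rewrite in_itv /= andbT.
  by move=> xf p; rewrite inE => /eqP ->.
by move=> /(_ (i, x)); apply; rewrite inE.
Qed.

Section path_of_process.
Context (dsp : measure_display) (Omega : measurableType dsp) (R : realType)
  (P : probability Omega R) (I : choiceType) (D : set I).
Implicit Types X Y Z : I -> {RV P >-> R}.

Definition path_of X : Omega -> path_space R D := fun w i => X i w.

(** Independence of processes speaks of events generated by the process, while
    functionals are measured on the path space; this is the passage between
    the two. *)
Lemma generated_sigma_algebra_path X (A : set (path_space R D)) :
  measurable A -> generated_sigma_algebra D X (path_of X @^-1` A).
Proof.
move: A; apply: smallest_sub.
  split=> [|A mA|F mF].
  - by rewrite preimage_set0; exact: sigma_algebra0.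
  - rewrite setTD preimage_setC -setTD; exact: sigma_algebraCD.
  - by rewrite preimage_bigcup; exact: sigma_algebra_bigcup.
move=> _ [s sD ->].
pose GX := [set E | exists i (B : set R),
  [/\ D i, measurable B & E = X i @^-1` B]].
elim: s sD => [_|[i t] s IH sD].
  rewrite (_ : _ @^-1` _ = setT); last by apply/seteqP; split.
  exact: (@measurableT _ (g_sigma_algebraType GX)).
rewrite (_ : _ @^-1` _ =
    (X i @^-1` `[t, +oo[) `&`
    (path_of X @^-1` [set f | forall p, p \in s -> p.2 <= f p.1])); last first.
  apply/seteqP; split=> w /=; rewrite in_itv /= andbT.
    move=> h; split; first by have := h (i, t); apply; rewrite inE eqxx.
    by move=> p ps; apply: h; rewrite inE ps orbT.
  by move=> [h1 h2] p; rewrite inE => /orP[/eqP ->//|]; exact: h2.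
apply: (@measurableI _ (g_sigma_algebraType GX)).
  apply: sub_sigma_algebra; exists i, `[t, +oo[%classic; split=> //.
  by apply: (sD (i, t)); rewrite inE eqxx.
by apply: IH => p ps; apply: sD; rewrite inE ps orbT.
Qed.

Lemma generated_sigma_algebra_measurable X (E : set Omega) :
  generated_sigma_algebra D X E -> measurable E.
Proof.
move: E; apply: smallest_sub.
  by apply: sigma_algebra_measurable.
by move=> _ [i [B [_ mB ->]]]; exact: measurable_funPTI.
Qed.

Lemma measurable_path_of X : measurable_fun setT (path_of X).
Proof.
move=> _ A mA; rewrite setTI.
apply: (@generated_sigma_algebra_measurable X).
exact: generated_sigma_algebra_path.
Qed.

End path_of_process.

(** * A zero-one law for fields that split into independent parts *)

Lemma rat_between_ereal (R : realType) (x y : \bar R) : (x < y)%E ->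
  exists q : rat, (x < (ratr q)%:E < y)%E.
Proof.
case: x => [x||]; case: y => [y||] //=.
- rewrite lte_fin => /rat_in_itvoo[q]; rewrite in_itv /= => xqy.
  by exists q; rewrite !lte_fin.
- move=> _; have /rat_in_itvoo[q] : x < x + 1 by rewrite ltrDl.
  by rewrite in_itv /= => /andP[xq _]; exists q; rewrite lte_fin xq ltry.
- move=> _; have /rat_in_itvoo[q] : y - 1 < y by rewrite gtrDl oppr_lt0.
  by rewrite in_itv /= => /andP[_ qy]; exists q; rewrite lte_fin qy ltNyr.
- by move=> _; exists 0; rewrite ltNyr ltry.
Qed.

Section almost_everywhere.
Context (dsp : measure_display) (Omega : measurableType dsp) (R : realType)
  (P : probability Omega R).

Lemma prob_setU_le (A B : set Omega) : measurable A -> measurable B ->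
  (P (A `|` B) <= P A + P B)%E.
Proof. exact: measureU2. Qed.

Lemma ae_forall_countable (T : countType) (Q : T -> Omega -> Prop) :
  (forall t, {ae P, forall w, Q t w}) -> {ae P, forall w, forall t, Q t w}.
Proof.
move=> aeQ.
have : {ae P, forall w, forall n, forall t, unpickle n = Some t -> Q t w}.
  apply: ae_foralln => n; case: (unpickle n) => [t|]; last exact: aeW.
  by apply: filterS (aeQ t) => w Qt _ [<-].
by apply: filterS => w Qw t; apply: (Qw (pickle t)); exact: pickleK.
Qed.

Lemma ae_exists (Q : Omega -> Prop) : {ae P, forall w, Q w} -> exists w, Q w.
Proof.
move=> [N [mN N0 QN]]; apply: contrapT => nQ.
have NT : N = setT.
  by apply/seteqP; split=> // w _; apply: QN => /= Qw; apply: nQ; exists w.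
have : P N = 0%E by [].
by rewrite NT probability_setT => /eqP; rewrite onee_eq0.
Qed.

Lemma ae_imp_prob_le (A B : set Omega) : measurable A -> measurable B ->
  {ae P, forall w, A w -> B w} -> (P A <= P B)%E.
Proof.
move=> mA mB [N [mN N0 ABN]].
apply: (@le_trans _ _ (P (B `|` N))).
  apply: le_measure; rewrite ?inE//; first exact: measurableU.
  move=> w Aw; have [Bw|nBw] := pselect (B w); [by left|right].
  by apply: ABN => /= /(_ Aw).
apply: (le_trans (prob_setU_le mB mN)).
by rewrite -[leRHS]adde0; apply: leeD => //; rewrite [leLHS]N0.
Qed.

Lemma ae_iff_prob (A B : set Omega) : measurable A -> measurable B ->
  {ae P, forall w, A w <-> B w} -> P A = P B.
Proof.
move=> mA mB AB; apply/eqP; rewrite eq_le.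
by apply/andP; split; apply: ae_imp_prob_le => //; apply: filterS AB => w [].
Qed.

End almost_everywhere.

Section zero_one.
Context (dsp : measure_display) (Omega : measurableType dsp) (R : realType)
  (P : probability Omega R) (I : choiceType) (D : set I).
Context (V : I -> {RV P >-> R}) (Y Z : nat -> I -> {RV P >-> R}).
Context (YZ : forall n, independent_processes D (Y n) (Z n)).
Context (YV : forall i (e : R), D i -> 0 < e ->
  P [set w | e <= `|Y n i w - V i w|] @[n --> \oo] --> 0%E).

Let upper_box (s : seq (I * R)) : set (path_space R D) :=
  [set f | forall p, p \in s -> p.2 <= f p.1].

Let shift (e : R) (s : seq (I * R)) := [seq (p.1, p.2 - e) | p <- s].

Let on (s : seq (I * R)) := forall p, p \in s -> D p.1.

Let on_shift e s : on s -> on (shift e s).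
Proof. by move=> sD _ /mapP[p ps ->]; exact: (sD _ ps). Qed.

Let upper_boxG s : on s -> @upper_boxes I R D (upper_box s).
Proof. by move=> sD; exists s. Qed.

Let measurable_upper_box s : on s -> measurable (upper_box s).
Proof. by move=> sD; apply: sub_sigma_algebra; exact: upper_boxG. Qed.

Let far (e : R) n (s : seq (I * R)) :=
  [set w | exists2 p, p \in s & e <= `|Y n p.1 w - V p.1 w|].

Let measurable_far1 (e : R) n i : measurable [set w | e <= `|Y n i w - V i w|].
Proof.
rewrite -[X in measurable X]setTI.
rewrite (_ : [set w | _] = (fun w => `|Y n i w - V i w|) @^-1` `[e, +oo[).
  have : measurable_fun setT (fun w => `|Y n i w - V i w|).
    by apply: measurableT_comp => //; exact: measurable_funB.
  by apply=> //; exact: measurable_itv.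
by apply/seteqP; split=> w /=; rewrite in_itv /= andbT.
Qed.

Let far_cons e n p s :
  far e n (p :: s) = [set w | e <= `|Y n p.1 w - V p.1 w|] `|` far e n s.
Proof.
apply/seteqP; split=> w /=.
  move=> [q]; rewrite inE => /orP[/eqP -> |qs] h; first by left.
  by right; exists q.
move=> [h|[q qs h]]; first by exists p => //; rewrite mem_head.
by exists q => //; rewrite inE qs orbT.
Qed.

Let far_nil e n : far e n [::] = set0.
Proof. by apply/seteqP; split=> // w []. Qed.

Let measurable_far e n s : measurable (far e n s).
Proof.
elim: s => [|p s IH]; first by rewrite far_nil.
by rewrite far_cons; exact: measurableU.
Qed.

Let far_small (e : R) s (d : R) : on s -> 0 < e -> 0 < d ->
  \forall n \near \oo, (P (far e n s) <= d%:E)%E.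
Proof.
move=> + e0; elim: s d => [|p s IH] d sD d0.
  by apply: nearW => n; rewrite far_nil measure0 lee_fin ltW.
have d20 : 0 < d / 2 by rewrite divr_gt0.
have /fine_cvgP[_ /cvgr0Pnorm_le/(_ _ d20) h] := YV (sD p (mem_head _ _)) e0.
have sD' : on s by move=> q qs; apply: sD; rewrite inE qs orbT.
near=> n; rewrite far_cons.
apply: (le_trans (@prob_setU_le _ _ _ P _ _ _ _)) => //.
rewrite [d in leRHS]splitr EFinD; apply: leeD; last by near: n; exact: IH.
rewrite -[leLHS]fineK ?fin_num_measure// lee_fin.
by apply: le_trans (ler_norm _) _; near: n.
Unshelve. all: by end_near. Qed.

(** Replacing [V] by [Y n] costs a small shift of the box and an event of small
    probability; the event [F] may be replaced by one that is determined by
    [Z n] and hence independent of [Y n]. *)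
Let upper_box_le (F : set Omega) (Fn : nat -> set Omega) s :
  measurable F -> (forall n, generated_sigma_algebra D (Z n) (Fn n)) ->
  (forall n H, measurable H -> P (H `&` F) = P (H `&` Fn n)) -> on s ->
  (P (path_of D V @^-1` upper_box s `&` F)
   <= P (path_of D V @^-1` upper_box s) * P F)%E.
Proof.
move=> mF ZF FFn sD.
have mpre (X : I -> {RV P >-> R}) t :
    on t -> measurable (path_of D X @^-1` upper_box t).
  move=> tD; rewrite -[X in measurable X]setTI.
  by apply: measurable_path_of => //; exact: measurable_upper_box.
have step (e : R) : 0 < e -> (P (path_of D V @^-1` upper_box s `&` F)
   <= P (path_of D V @^-1` upper_box (shift (e + e) s)) * P F)%E.
  move=> e0; apply/lee_addgt0Pr => d d0.
  have d20 : 0 < d / 2 by rewrite divr_gt0.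
  have [n _ /(_ n (leqnn n)) Pfar] := far_small sD e0 d20.
  have mY := mpre (Y n) (shift e s) (@on_shift e s sD).
  have mfar := measurable_far e n s.
  have mV := mpre V (shift (e + e) s) (@on_shift (e + e) s sD).
  have PFn : P (Fn n) = P F.
    by have := FFn n setT measurableT; rewrite !setTI.
  apply: (@le_trans _ _
     (P (path_of D (Y n) @^-1` upper_box (shift e s) `&` F `|` far e n s))).
    apply: le_measure; rewrite ?inE.
    - by apply: measurableI => //; exact: mpre.
    - by apply: measurableU => //; exact: measurableI.
    move=> w /= [Vs Fw].
    have [fw|nfw] := pselect (far e n s w); [by right|left; split=> //].
    move=> _ /mapP[p ps ->] /=; have := Vs p ps.
    rewrite /path_of leNgt => Vp; rewrite leNgt; apply/negP => Yp.
    apply: nfw; exists p => //; rewrite distrC.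
    apply: le_trans (ler_norm _); lra.
  apply: (le_trans (@prob_setU_le _ _ _ P _ _ _ _)) => //; first exact:
      measurableI.
  have {1}-> : d = d / 2 + d / 2 by rewrite -splitr.
  rewrite EFinD addeA; apply: leeD => //.
  rewrite (FFn n) //.
  rewrite (YZ (n := n)); last 2 first.
  - apply: generated_sigma_algebra_path; apply: measurable_upper_box.
    exact: on_shift.
  - exact: ZF.
  rewrite PFn; apply: (@le_trans _ _ ((P (path_of D V @^-1` upper_box
      (shift (e + e) s)) + (d / 2)%:E) * P F)%E).
    apply: lee_wpmul2r => //.
    apply: (@le_trans _ _ (P (path_of D V @^-1` upper_box
        (shift (e + e) s) `|` far e n s))).
      apply: le_measure; rewrite ?inE//; first exact: measurableU.
      move=> w /= Ys.
      have [fw|nfw] := pselect (far e n s w); [by right|left].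
      move=> _ /mapP[p ps ->] /=.
      have := Ys (p.1, p.2 - e); rewrite /path_of /=.
      move=> /(_ (map_f _ ps)) Yp; rewrite leNgt; apply/negP => Vp.
      apply: nfw; exists p => //.
      apply: le_trans (ler_norm _); lra.
    apply: (le_trans (@prob_setU_le _ _ _ P _ _ _ _)) => //.
    exact: leeD.
  rewrite muleDl ?fin_num_measure//; last by rewrite fin_num_adde_defl.
  rewrite leeD2l// -[leRHS]mule1; apply: lee_wpmul2l; first exact: ltW.
  exact: probability_le1.
pose B m := path_of D V @^-1` upper_box (shift (m.+1%:R^-1) s).
have Bs : \bigcap_m B m = path_of D V @^-1` upper_box s.
  apply/seteqP; split=> w /=; last first.
    move=> Vs m _ _ /mapP[p ps ->] /=; apply: le_trans (Vs p ps).
    by rewrite gerBl.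
  move=> BV p ps; apply/ler_addgt0Pr => e e0.
  have [m me] := ltr_add_invr e0; rewrite add0r in me.
  have := BV m Logic.I (p.1, p.2 - m.+1%:R^-1) (map_f _ ps).
  move=> /= Vp; rewrite -lerBlDr; apply: le_trans Vp.
  by rewrite lerB// ltW.
have PB : (P \o B) @ \oo --> P (path_of D V @^-1` upper_box s).
  rewrite -Bs; apply: nonincreasing_cvg_mu.
  - by rewrite (le_lt_trans (probability_le1 _ _)) ?ltry//; apply: mpre;
      exact: on_shift.
  - by move=> m; apply: mpre; exact: on_shift.
  - by rewrite Bs; exact: mpre.
  - move=> m n mn; apply/subsetPset => w Bn _ /mapP[p ps ->] /=.
    have := Bn (p.1, p.2 - n.+1%:R^-1) (map_f _ ps).
    apply: le_trans; rewrite /= lerB// lef_pV2 ?posrE//.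
    by rewrite ler_nat.
have h := cvgeZr (fin_num_measure P _ mF) PB.
rewrite -(cvg_lim _ h)//; apply: lime_ge; first exact: (cvgP _ h).
apply: nearW => m /=.
rewrite /B (splitr m.+1%:R^-1); apply: step; rewrite divr_gt0//.
Qed.


(** An event on the path of [V] that, up to null events, is also an event on
    the path of [Z n] for every [n] is independent of the boxes, hence of the
    path of [V], hence of itself. *)
Lemma zero_one_law (A : set (path_space R D)) : measurable A ->
  (forall n, {ae P, forall w, A (path_of D V w) <-> A (path_of D (Z n) w)}) ->
  P (path_of D V @^-1` A) = 0%E \/ P (path_of D V @^-1` A) = 1%E.
Proof.
move=> mA AVZ; set E := path_of D V @^-1` A.
have mpre (X : I -> {RV P >-> R}) (B : set (path_space R D)) :
    measurable B -> measurable (path_of D X @^-1` B).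
  by move=> mB; rewrite -[X in measurable X]setTI; exact: measurable_path_of.
have mE : measurable E by exact: mpre.
have PE (B : set (path_space R D)) n H : 
    measurable B ->
    {ae P, forall w, B (path_of D V w) <-> B (path_of D (Z n) w)} ->
    measurable H -> P (H `&` path_of D V @^-1` B) =
    P (H `&` path_of D (Z n) @^-1` B).
  move=> mB BVZ mH.
  apply: ae_iff_prob.
  - by apply: measurableI => //; exact: mpre.
  - by apply: measurableI => //; exact: mpre.
  - by apply: filterS BVZ => w /= BZ; split=> -[Hw] /BZ.
have upper s : on s -> (P (path_of D V @^-1` upper_box s `&` E)
    = P (path_of D V @^-1` upper_box s) * P E)%E.
  move=> sD; set C := _ @^-1` upper_box s.
  have mC : measurable C by apply: mpre; exact: measurable_upper_box.
  apply/eqP; rewrite eq_le; apply/andP; split.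
    apply: (upper_box_le (Fn :=
        fun n => path_of D (Z n) @^-1` A)) => // [n|n H mH].
      exact: generated_sigma_algebra_path.
    exact: PE.
  (* The bounds for E and for its complement add up to the identity
     P C = P C, so that both are equalities. *)
  have : (P (C `&` ~` E) <= P C * P (~` E))%E.
    apply: (upper_box_le (Fn := fun n => path_of D (Z n) @^-1` (~` A))) => //.
    - exact: measurableC.
    - by move=> n; apply: generated_sigma_algebra_path; exact: measurableC.
    - move=> n H mH; rewrite /E preimage_setC; apply: PE => //.
        exact: measurableC.
      by apply: filterS (AVZ n) => w /=; tauto.
  have PC : P C = (P (C `&` E) + P (C `&` ~` E))%E.
    rewrite -measureU//.
    - by rewrite -setIUr setUv setIT.
    - exact: measurableI.
    - by apply: measurableI => //; exact: measurableC.
    - by rewrite setIACA setICr setI0.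
  rewrite probability_setC//.
  have finE : P E \is a fin_num by exact: fin_num_measure.
  have finC : P C \is a fin_num by exact: fin_num_measure.
  have finCE : P (C `&` E) \is a fin_num.
    by apply: fin_num_measure; exact: measurableI.
  have finCE' : P (C `&` ~` E) \is a fin_num.
    by apply: fin_num_measure; apply: measurableI => //; exact: measurableC.
  move: PC; rewrite -(fineK finE) -(fineK finC) -(fineK finCE) -(fineK finCE').
  rewrite -EFinB -EFinD -!EFinM !lee_fin => -[->]; lra.
(* Two measures on the path space that agree on the pi-system of boxes: the
   law of V restricted to E, and the law of V multiplied by P E. *)
have pE0 : 0 <= fine (P E) by rewrite fine_ge0.
have mV := @measurable_path_of _ _ _ P I D V.
pose m1 : {measure set path_space R D -> \bar R} :=
  measure_function_pushforward__canonical__measure_function_Measure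
    (mrestr P mE) mV.
pose m2 : {measure set path_space R D -> \bar R} :=
  mscale (NngNum pE0)
    (measure_function_pushforward__canonical__measure_function_Measure P mV).
have : m1 A = m2 A.
  apply: (@measure_unique _ R (path_space R D) (@upper_boxes I R D)
    (fun=> setT) erefl (@setI_closed_upper_boxes I R D) _ _ m1 m2) => //.
  - by move=> _; exists [::] => //; apply/seteqP; split.
  - by rewrite bigcup_const//; exists 0%N.
  - move=> _ [s sD ->]; 
    transitivity (P (path_of D V @^-1` upper_box s) * P E)%E.
      exact: upper.
    by rewrite muleC -[X in (X * _)%E = _](fineK (fin_num_measure P _ mE)).
  - move=> _; apply: (@le_lt_trans _ _ (P (setT `&` E))) => //.
    by rewrite (le_lt_trans (probability_le1 _ _)) ?ltry// setTI.
have -> : m1 A = P E by rewrite -[in RHS](setIid E).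
have -> : m2 A = (P E * P E)%E.
  by rewrite -[X in _ = (X * _)%E](fineK (fin_num_measure P _ mE)).
rewrite -(fineK (fin_num_measure P _ mE)) -EFinM => -[].
move=> /eqP; rewrite -subr_eq0 -{1}[fine _]mulr1 -mulrBr mulf_eq0 subr_eq0.
by move=> /orP[/eqP ->|/eqP <-]; [left|right].
Qed.

(** All sublevel events of the functional at rational levels have probability
    zero or one; the constant is the infimum of the levels of probability
    one. *)
Lemma zero_one_constant (G : path_space R D -> \bar R) :
  measurable_fun setT G ->
  (forall n, {ae P, forall w, G (path_of D V w) = G (path_of D (Z n) w)}) ->
  exists kappa : \bar R, {ae P, forall w, G (path_of D V w) = kappa}.
Proof.
move=> mG GVZ.
pose A (q : rat) : set (path_space R D) :=
  G @^-1` [set x | (x <= (ratr q)%:E)%E].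
have mA q : measurable (A q).
  rewrite /A -[X in measurable X]setTI; apply: mG => //.
  rewrite (_ : [set x | _] = `]-oo, (ratr q)%:E]%classic).
    exact: emeasurable_itv.
  by apply/seteqP; split=> x /=; rewrite in_itv.
have A01 q : P (path_of D V @^-1` A q) = 0%E \/
    P (path_of D V @^-1` A q) = 1%E.
  apply: zero_one_law => // n; apply: filterS (GVZ n) => w.
  by rewrite /A /= => ->.
have mVA q : measurable (path_of D V @^-1` A q).
  by rewrite -[X in measurable X]setTI; exact: measurable_path_of.
pose S := [set x : \bar R | exists2 q : rat,
  P (path_of D V @^-1` A q) = 1%E & x = (ratr q)%:E].
exists (ereal_inf S).
have : {ae P, forall w, forall q : rat,
    A q (path_of D V w) <-> P (path_of D V @^-1` A q) = 1%E}.
  apply: ae_forall_countable => q; case: (A01 q) => Aq; rewrite Aq.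
    exists (path_of D V @^-1` A q); split=> // w /= nAq.
    apply/not_notP => nA; apply: nAq; split=> // /eqP.
    by rewrite eqe eq_sym oner_eq0.
  exists (path_of D V @^-1` (~` A q)); split.
  - by rewrite -preimage_setC; exact: measurableC.
  - by rewrite -preimage_setC probability_setC// Aq subee.
  - by move=> w /= nAq Aw; apply: nAq.
apply: filterS => w Aw; apply/eqP; rewrite eq_le; apply/andP; split.
  by apply: le_ereal_inf_tmp => _ [q /Aw Gq ->].
rewrite leNgt; apply/negP => GS.
have [q /andP[Gq qS]] := rat_between_ereal GS.
have : (ereal_inf S <= (ratr q)%:E)%E.
  by apply: ereal_inf_lbound; exists q => //; apply/Aw; exact: ltW.
by rewrite leNgt qS.
Qed.

End zero_one.

(** * L2 norms and tails of centered Gaussian variables *)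

Section L2norm.
Context (dsp : measure_display) (Omega : measurableType dsp) (R : realType)
  (P : probability Omega R).
Implicit Types X Y : Omega -> R.

Lemma L2norm_ge0 X : (0 <= L2norm P X)%E.
Proof. exact: Lnorm_ge0. Qed.

Lemma L2normN X : L2norm P (fun w => - X w) = L2norm P X.
Proof. exact: (oppe_Lnorm P (EFin \o X) 2%:E). Qed.

Lemma L2norm_ae X Y : measurable_fun setT X -> measurable_fun setT Y ->
  {ae P, forall w, X w = Y w} -> L2norm P X = L2norm P Y.
Proof.
move=> mX mY XY; rewrite /L2norm unlock.
have -> // : (\int[P]_w (`|(EFin \o X) w| `^ 2) =
  \int[P]_w (`|(EFin \o Y) w| `^ 2))%E.
apply: ae_eq_integral => //.
- apply: (@measurableT_comp _ _ _ _ _ _ (@poweR R ^~ 2)) => //.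
    exact: measurable_poweR.
  by apply: measurableT_comp => //; exact/measurable_EFinP.
- apply: (@measurableT_comp _ _ _ _ _ _ (@poweR R ^~ 2)) => //.
    exact: measurable_poweR.
  by apply: measurableT_comp => //; exact/measurable_EFinP.
- by apply: filterS XY => w /= -> _.
Qed.

Lemma L2normD X Y : measurable_fun setT X -> measurable_fun setT Y ->
  (L2norm P (fun w => X w + Y w)%R <= L2norm P X + L2norm P Y)%E.
Proof. by move=> mX mY; apply: minkowski_EFin => //; rewrite ler1n. Qed.

Lemma L2norm_chebyshev X (c a : R) : measurable_fun setT X ->
  (L2norm P X <= c%:E)%E -> 0 < a ->
  (P [set w | (a <= `|X w|)%R] <= (c ^+ 2 / a ^+ 2)%:E)%E.
Proof.
move=> mX Xc a0.
have c0 : 0 <= c by rewrite -lee_fin; exact: le_trans (L2norm_ge0 X) Xc.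
have := @le_integral_comp_abse _ _ _ P _ measurableT (EFin \o X) a
  (fun x => x `^ 2)%E (measurable_poweR 2) (fun r _ => poweR_ge0 r 2).
have h : {in `[0%E, +oo[%classic &, {homo (fun x : \bar R => x `^ 2)%E :
    x y / (x <= y)%E}}.
  move=> x y; rewrite !inE /= !in_itv /= !andbT => x0 y0 xy.
  by apply: gt0_ler_poweR => //; rewrite in_itv /= ?x0 ?y0 leey.
move=> /(_ h _ a0); rewrite setTI => /(_ _)/le_trans H.
have {}H : (a%:E `^ 2 * P [set w | (a <= `|X w|)%R] <= c%:E `^ 2)%E.
  apply: H; first exact/measurable_EFinP.
  rewrite -[leLHS](@poweR_Lnorm _ _ _ P (EFin \o X) 2)//.
  by apply: gt0_ler_poweR => //; rewrite in_itv /= ?leey ?andbT ?lee_fin//;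
    exact: L2norm_ge0.
move: H; rewrite !poweR_EFin !powR_mulrn ?(ltW a0)// => H.
rewrite EFinM lee_pdivlMr ?exprn_gt0// muleC; exact: H.
Qed.

End L2norm.

(** Doubling the scale of the density costs a factor two in its peak and leaves
    room in the exponent. Integrated over the tail event this gives a Gaussian
    tail bound, because the density of scale [2 * s] has total mass one. *)
Lemma normal_pdf_tail (R : realType) (s t x : R) : 0 < s -> 0 <= t ->
  t <= `|x| ->
  normal_pdf 0 s x <= 2 * expR (- (t / (2 * s)) ^+ 2) * normal_pdf 0 (2 * s) x.
Proof.
move=> s0 t0 tx; have s20 : 0 < 2 * s by rewrite mulr_gt0.
rewrite !normal_pdfE ?gt_eqF// /normal_peak /normal_fun !subr0.
have -> : Num.sqrt ((2 * s) ^+ 2 * pi *+ 2) = 2 * Num.sqrt (s ^+ 2 * pi *+ 2).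
  rewrite [X in Num.sqrt X](_ : _ = 2 ^+ 2 * (s ^+ 2 * pi *+ 2)).
    by rewrite sqrtrM ?sqr_ge0// sqrtr_sqr ger0_norm.
  by ring.
set p := Num.sqrt _.
have p0 : 0 < p.
  by rewrite sqrtr_gt0 mulrn_wgt0// mulr_gt0 ?pi_gt0// exprn_gt0.
set e1 := expR (- (t / (2 * s)) ^+ 2).
set e2 := expR (- x ^+ 2 / ((2 * s) ^+ 2 *+ 2)).
rewrite [leRHS](_ : _ = p^-1 * (e1 * e2)); last by field; rewrite gt_eqF.
rewrite ler_pM2l ?invr_gt0// -expRD ler_expR.
have tx2 : t ^+ 2 <= x ^+ 2.
  by rewrite -[x ^+ 2]real_normK ?num_real// ler_pXn2r ?nnegrE.
rewrite -subr_ge0 [X in 0 <= X](_ : _ =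
   (x ^+ 2 - t ^+ 2) / (4 * s ^+ 2) + x ^+ 2 / (8 * s ^+ 2)).
  by apply: addr_ge0; apply: divr_ge0; rewrite ?subr_ge0 ?sqr_ge0//;
    apply: mulr_ge0 => //; exact: sqr_ge0.
by field; rewrite gt_eqF.
Qed.

Lemma measurable_norm_ge (R : realType) (t : R) :
  measurable [set x : R | t <= `|x|].
Proof.
rewrite -[X in measurable X]setTI.
rewrite (_ : [set w | _] = (fun w : R => `|w|) @^-1` `[t, +oo[).
  by have : measurable_fun setT (fun w : R => `|w|) by []; apply.
by apply/seteqP; split=> w /=; rewrite in_itv /= andbT.
Qed.

Lemma normal_prob_tail (R : realType) (s t : R) : 0 < s -> 0 <= t ->
  (normal_prob 0 s [set x | (t <= `|x|)%R]
   <= (2 * expR (- (t / (2 * s)) ^+ 2))%:E)%E.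
Proof.
move=> s0 t0; have mt := measurable_norm_ge t.
set C := 2 * _; have C0 : 0 <= C by rewrite mulr_ge0 ?expR_ge0.
rewrite /normal_prob.
apply: (@le_trans _ _ (\int[@lebesgue_measure R]_(x in [set x : R | (t <=
    `|x|)%R])
   (C%:E * (normal_pdf 0 (2 * s) x)%:E))%E).
  apply: ge0_le_integral => //.
  - by move=> x _; rewrite lee_fin normal_pdf_ge0.
  - by apply/measurable_EFinP/measurable_funTS; exact: measurable_normal_pdf.
  - apply/measurable_EFinP/measurable_funTS; apply: measurable_funM => //.
    exact: measurable_normal_pdf.
  - by move=> x tx; rewrite -EFinM lee_fin; exact: normal_pdf_tail.
rewrite ge0_integralZl//; last 2 first.
- by apply/measurable_EFinP/measurable_funTS; exact: measurable_normal_pdf.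
- by move=> x _; rewrite lee_fin normal_pdf_ge0.
rewrite -[leRHS]mule1; apply: lee_wpmul2l => //.
exact: (probability_le1 (normal_prob 0 (2 * s)) mt).
Qed.

(** An interval of length [s] has mass at most [s] times the peak of the
    density, and this is at most one half because [2 <= pi]. *)
Lemma normal_prob_half (R : realType) (s : R) : 0 < s ->
  (2^-1%:E <= normal_prob 0 s [set x | (s / 2 <= `|x|)%R])%E.
Proof.
move=> s0; have mt := measurable_norm_ge (s / 2).
pose N : probability _ R := normal_prob 0 s.
have -> : [set x | s / 2 <= `|x|] = ~` `](- (s / 2)), (s / 2)[%classic.
  apply/seteqP; split=> x /=; rewrite in_itv /= -ltr_norml.
    by move=> h; apply/negP; rewrite -leNgt.
  by move/negP; rewrite -leNgt.
rewrite -[normal_prob _ _]/(N : set _ -> _) probability_setC//.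
have : (N `](- (s / 2))%R, (s / 2)%R[%classic <= 2^-1%:E)%E.
  apply: (@le_trans _ _ (\int[lebesgue_measure]_(x in `](- (s / 2))%R,
      (s / 2)%R[) (normal_peak s)%:E)%E).
    apply: ge0_le_integral => //.
    - by move=> x _; rewrite lee_fin normal_pdf_ge0.
    - by apply/measurable_EFinP/measurable_funTS; exact: measurable_normal_pdf.
    - by move=> x _; rewrite lee_fin normal_pdf_ub// gt_eqF.
  rewrite integral_cst//= lebesgue_measure_itv /= lte_fin gtrN ?divr_gt0//.
  rewrite -EFinB -EFinM lee_fin opprK -splitr /normal_peak mulrC.
  rewrite ler_pdivrMr; last first.
    by rewrite sqrtr_gt0 mulrn_wgt0// mulr_gt0 ?pi_gt0// exprn_gt0.
  rewrite mulrC ler_pdivlMr//.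
  rewrite -[leLHS]ger0_norm ?mulr_ge0 ?(ltW s0)// -sqrtr_sqr ler_wsqrtr//.
  rewrite (_ : s ^+ 2 * pi *+ 2 = s ^+ 2 * (pi * 2)); last by ring.
  by rewrite exprMn ler_wpM2l ?sqr_ge0//; have := pi_ge2 R; lra.
have : N `](- (s / 2)), (s / 2)[%classic \is a fin_num by exact:
    fin_num_measure.
move=> /fineK <-; rewrite -EFinB !lee_fin; lra.
Qed.

Section gaussian.
Context (dsp : measure_display) (Omega : measurableType dsp) (R : realType)
  (P : probability Omega R).
Implicit Types X : Omega -> R.

(** Chebyshev's inequality at half the scale, where a centered normal law still
    has mass one half. *)
Lemma gaussian_scale_le X (s c : R) : measurable_fun setT X -> 0 < s ->
  (forall B, measurable B -> P (X @^-1` B) = normal_prob 0 s B) ->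
  (L2norm P X <= c%:E)%E -> s <= 3 * c.
Proof.
move=> mX s0 XE Xc.
have c0 : 0 <= c by rewrite -lee_fin; exact: le_trans (L2norm_ge0 P X) Xc.
have s20 : 0 < s / 2 by rewrite divr_gt0.
have := L2norm_chebyshev mX Xc s20.
rewrite -[[set w | _]]/(X @^-1` [set x | s / 2 <= `|x|]) XE; last first.
  exact: measurable_norm_ge.
move=> /(le_trans (normal_prob_half s0)); rewrite lee_fin.
rewrite ler_pdivlMr ?exprn_gt0// => h.
rewrite -(@ler_pXn2r _ 2)// ?nnegrE ?(ltW s0) ?mulr_ge0//.
by move: h (sqr_ge0 c); rewrite !exprMn; lra.
Qed.

Lemma gaussian_tail X (c t : R) : centered_gaussian P X ->
  measurable_fun setT X -> (L2norm P X <= c%:E)%E -> 0 < c -> 0 < t ->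
  (P [set w | (t <= `|X w|)%R] <= (2 * expR (- (t / (6 * c)) ^+ 2))%:E)%E.
Proof.
move=> [s s0 XE] mX Xc c0 t0.
rewrite -[[set w | _]]/(X @^-1` [set x | t <= `|x|]).
have mt := measurable_norm_ge t.
have [s_eq0|sn0] := eqVneq s 0.
  rewrite XE// /centered_gaussian_law s_eq0 eqxx diracE memNset.
    by rewrite lee_fin mulr_ge0 ?expR_ge0.
  by rewrite /= normr0 leNgt t0.
have {}s0 : 0 < s by rewrite lt_def sn0.
have {}XE B : measurable B -> P (X @^-1` B) = normal_prob 0 s B.
  by move=> /XE; rewrite /centered_gaussian_law (negbTE sn0).
rewrite XE//; apply: le_trans (normal_prob_tail s0 (ltW t0)) _.
rewrite lee_fin ler_pM2l// ler_expR lerN2 ler_pXn2r// ?nnegrE.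
- rewrite ler_pM2l// lef_pV2 ?posrE ?mulr_gt0//.
  by have := gaussian_scale_le mX s0 XE Xc; lra.
- by rewrite divr_ge0 ?(ltW t0)// mulr_ge0// ltW.
- by rewrite divr_ge0 ?(ltW t0)// mulr_ge0// ltW.
Qed.

End gaussian.

(** * Additivity of independently scattered noise *)

Section scattered.
Context (dsp : measure_display) (Omega : measurableType dsp) (R : realType)
  (P : probability Omega R).
Implicit Types (X Y : Omega -> R) (W : set R -> {RV P >-> R}).

Lemma L2norm_eq0 X : measurable_fun setT X -> L2norm P X = 0%E ->
  {ae P, forall w, X w = 0}.
Proof.
move=> mX X0.
have mEX : measurable_fun setT (EFin \o X) by exact/measurable_EFinP.
have := Lnorm_eq0_eq0 mEX (lte0n 2) X0.
by apply: filterS => w /= /(_ Logic.I) [].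
Qed.

Lemma L2normB X Y : measurable_fun setT X -> measurable_fun setT Y ->
  (L2norm P (fun w => X w - Y w)%R <= L2norm P X + L2norm P Y)%E.
Proof.
move=> mX mY; rewrite -(L2normN P Y).
by apply: (@L2normD _ _ _ P X (fun w => - Y w)%R) => //; exact:
    measurableT_comp.
Qed.

Lemma borel_nonneg0 : borel_nonneg (@set0 R).
Proof. by split. Qed.

Let mS (W : set R -> {RV P >-> R}) (A : nat -> set R) n :
  measurable_fun setT (fun w => \sum_(i < n) W (A i) w).
Proof. by apply: measurable_sum => i. Qed.

(** Additivity over a sequence of empty sets says that [W set0] minus [n] times
    [W set0] tends to 0, and consecutive terms of this sequence differ by
    [W set0]. *)
Lemma scattered_set0 W : independently_scattered W ->
  {ae P, forall w, W set0 w = 0}.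
Proof.
move=> [_ addW]; apply: L2norm_eq0 => //.
have tr0 : trivIset setT (fun _ : nat => @set0 R).
  by apply/trivIsetP => i j _ _ _; rewrite setI0.
have := addW (fun=> set0) (fun=> borel_nonneg0) tr0.
rewrite bigcup0//; set u := (fun n : nat => _) => u0.
have u01 : (fun n => u n + u n.+1)%E @ \oo --> (0 + 0)%E.
  by apply: cvgeD => //; move: u0; rewrite -cvg_shiftS.
rewrite adde0 in u01.
apply/eqP; rewrite eq_le L2norm_ge0 andbT -(cvg_lim _ u01)//.
apply: lime_ge; first exact: (cvgP _ u01).
apply: nearW => n.
rewrite (_ : (W set0 : Omega -> R) =
  (fun w => (W set0 w - \sum_(i < n) W set0 w)
         - (W set0 w - \sum_(i < n.+1) W set0 w))); last first.
  by apply/funext => w; rewrite !big_const_ord !iter_addr_0 mulrS; lra.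
apply: L2normB.
- by apply: measurable_funB => //; exact: (mS W (fun=> set0)).
- by apply: measurable_funB => //; exact: (mS W (fun=> set0)).
Qed.

(** The sequence of partial sums is almost surely constant from [N] on, so that
    its limit in L2 is attained. *)
Lemma scattered_finite_additive W (A : nat -> set R) N :
  independently_scattered W -> (forall i, borel_nonneg (A i)) ->
  trivIset setT A -> (forall i, (N <= i)%N -> A i = set0) ->
  {ae P, forall w, W (\bigcup_i A i) w = \sum_(i < N) W (A i) w}.
Proof.
move=> hW bA tA A0; have W0 := scattered_set0 hW.
have mD n : measurable_fun setT
    (fun w => W (\bigcup_i A i) w - \sum_(i < n) W (A i) w).
  by apply: measurable_funB => //; exact: mS.
have : L2norm P (fun w => W (\bigcup_i A i) w - \sum_(i < N) W (A i) w) = 0%E.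
  have [_ /(_ A bA tA) u0] := hW.
  rewrite -(cvg_lim _ u0)//; apply/esym/lim_near_cst => //.
  exists N => // n /= Nn; apply: L2norm_ae => //; [exact: mD|exact: mD|].
  apply: filterS W0 => w W0w; congr (_ - _).
  rewrite -!(big_mkord xpredT (fun i => W (A i) w)).
  rewrite (big_cat_nat (n := N))//= [X in _ + X]big_nat.
  by rewrite [X in _ + X]big1 ?addr0// => i /andP[Ni _]; rewrite A0.
move=> /L2norm_eq0 => /(_ (mD N)); apply: filterS => w /eqP.
by rewrite subr_eq0 => /eqP.
Qed.

Lemma scattered_setU W (A B : set R) :
  independently_scattered W -> borel_nonneg A -> borel_nonneg B ->
  A `&` B = set0 -> {ae P, forall w, W (A `|` B) w = W A w + W B w}.
Proof.
move=> hW bA bB AB.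
pose S i := if i is 0%N then A else if i is 1%N then B else set0.
have bS i : borel_nonneg (S i).
  by case: i => [|[|i]] //; exact: borel_nonneg0.
have tS : trivIset setT S.
  apply/trivIsetP => -[|[|i]] [|[|j]] //= _ _ _; rewrite ?setI0 ?set0I//.
  by rewrite setIC.
have := @scattered_finite_additive W S 2 hW bS tS.
rewrite (_ : \bigcup_i S i = A `|` B); last first.
  apply/seteqP; split=> t /=.
    by move=> [[|[|i]] _] //= ?; [left|right].
  by move=> [?|?]; [exists 0%N|exists 1%N].
move=> h; apply: filterS (h _) => [w ->|[|[|i]]//].
by rewrite big_ord_recr big_ord_recr big_ord0 /= add0r.
Qed.

Lemma borel_nonneg_ico (a : R) (b : \bar R) : 0 <= a -> borel_nonneg (ico a b).
Proof.
move=> a0; split; last by move=> t [at_ _]; exact: le_trans at_.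
rewrite (_ : ico a b = `[a, +oo[%classic `&` (EFin @^-1` `]-oo, b[%classic)).
  apply: measurableI => //; rewrite -[X in measurable X]setTI.
  by have : measurable_fun setT (@EFin R) by []; apply => //; exact:
      emeasurable_itv.
by apply/seteqP; split=> t /=; rewrite !in_itv /= andbT.
Qed.

Lemma borel_nonneg_nonneg : borel_nonneg (@nonneg R).
Proof.
split=> //; rewrite (_ : @nonneg R = `[0, +oo[%classic)//.
by apply/seteqP; split=> t /=; rewrite !in_itv /= andbT.
Qed.

Lemma ico_split (a b : R) (c : \bar R) : a <= b -> (b%:E <= c)%E ->
  ico a c = ico a b%:E `|` ico b c.
Proof.
move=> ab bc; apply/seteqP; split=> t; rewrite /ico /=.
  move=> [at_ tc]; have [tb|bt] := ltP t b; [left|right] => //.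
move=> [[at_ tb]|[bt tc]]; split=> //; first exact: lt_le_trans tb bc.
exact: le_trans ab bt.
Qed.

Lemma ico_disjoint (a b : R) (c : \bar R) :
  ico a b%:E `&` ico b c = set0.
Proof.
apply/seteqP; split=> t //=; rewrite /ico /= lte_fin => -[[_ tb] [bt _]].
by move: tb; rewrite ltNge bt.
Qed.

Lemma nonneg_ico : @nonneg R = ico 0 +oo%E.
Proof. by apply/seteqP; split=> t /=; [split; rewrite ?ltry|case]. Qed.

Lemma scattered_ico W (a b : R) (c : \bar R) : independently_scattered W ->
  0 <= a -> a <= b -> (b%:E <= c)%E ->
  {ae P, forall w, W (ico a c) w = W (ico a b%:E) w + W (ico b c) w}.
Proof.
move=> hW a0 ab bc; rewrite (ico_split ab bc).
apply: scattered_setU => //; last exact: ico_disjoint.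
- exact: borel_nonneg_ico.
- by apply: borel_nonneg_ico; exact: le_trans ab.
Qed.

Lemma scattered_ico_cvg W : independently_scattered W ->
  L2norm P (fun w => W (@nonneg R) w - W (ico 0 n%:R%:E) w) @[n --> \oo]
    --> 0%E.
Proof.
move=> hW; pose A i : set R := ico i%:R i.+1%:R%:E.
have bA i : borel_nonneg (A i) by exact: borel_nonneg_ico.
have tA : trivIset setT A.
  apply: ltn_trivIset => i j ij; apply/seteqP; split=> t //=.
  rewrite /A /ico /= !lte_fin => -[[_ ti] [jt _]].
  have : (j.+1%:R : R) <= i%:R by rewrite ler_nat.
  by move: ti jt; lra.
have AU : \bigcup_i A i = @nonneg R.
  apply/seteqP; split=> t /=.
    by move=> [i _ [it _]]; exact: le_trans it.
  move=> t0; exists (Num.truncn t) => //; rewrite /A /ico /= lte_fin.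
  by have /andP[] := truncn_itv t0.
have [_ /(_ A bA tA)] := hW; rewrite AU.
apply: cvg_trans; apply: near_eq_cvg; apply: nearW => n.
apply: L2norm_ae.
- by apply: measurable_funB => //; exact: mS.
- exact: measurable_funB.
elim: n => [|n IH].
  have -> : ico 0 (0%:R%:E : \bar R) = set0 :> set R.
    by rewrite -[LHS]setIid ico_disjoint.
  by apply: filterS (scattered_set0 hW) => w ->; rewrite big_ord0.
have := @scattered_ico W 0 n%:R n.+1%:R%:E hW (lexx _) (ler0n _ _).
rewrite lee_fin ler_nat leqnSn => /(_ isT); apply: filterS2 IH => w.
by rewrite big_ord_recr /=; rewrite /A; lra.
Qed.

End scattered.

(** * Chaining along nets *)

Definition l1dist (R : realType) (k : nat) (x y : 'rV[R]_k) : R :=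
  \sum_(j < k) `|x 0 j - y 0 j|.

Section l1dist.
Context (R : realType) (k : nat).
Implicit Types x y z : 'rV[R]_k.

Lemma l1dist_ge0 x y : 0 <= l1dist x y.
Proof. by apply: sumr_ge0. Qed.

Lemma l1distC x y : l1dist x y = l1dist y x.
Proof. by apply: eq_bigr => j _; rewrite distrC. Qed.

Lemma l1distxx x : l1dist x x = 0.
Proof. by apply: big1 => j _; rewrite subrr normr0. Qed.

Lemma l1dist_triangle x y z : l1dist x z <= l1dist x y + l1dist y z.
Proof.
rewrite /l1dist -big_split /=; apply: ler_sum => j _.
by rewrite (_ : x 0 j - z 0 j = (x 0 j - y 0 j) + (y 0 j - z 0 j))
    ?ler_normD//; ring.
Qed.

Lemma l1dist_coord x y j : `|x 0 j - y 0 j| <= l1dist x y.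
Proof.
rewrite /l1dist (bigD1 j)//= lerDl; exact: sumr_ge0.
Qed.

Lemma l1dist_eq0 x y : l1dist x y = 0 -> x = y.
Proof.
move=> xy0; apply/rowP => j; apply/eqP; rewrite -subr_eq0 -normr_le0 -xy0.
exact: l1dist_coord.
Qed.

End l1dist.

(** The crude geometric bound on the size of the levels suffices: at the scale
    of the mesh the probabilities decay super-exponentially, which even pays
    for the square of the size, that is for all pairs. *)
Definition chaining_nets (R : realType) (k : nat) (T : set 'rV[R]_k)
    (N : nat -> seq 'rV[R]_k) : Prop :=
  [/\ forall m x, x \in N m -> T x,
      forall m x, x \in N m -> x \in N m.+1,
      exists2 L : R, 0 < L & forall m x, T x ->
        exists2 y, y \in N m & l1dist x y <= L * 2^-1 ^+ m &
      exists A B : nat, forall m, (size (N m) <= A * B ^ m)%N].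

Definition net_points (R : realType) (k : nat) (N : nat -> seq 'rV[R]_k) :
    set 'rV[R]_k :=
  [set x | exists m, x \in N m].

Definition locally_hoelder (R : realType) (k : nat) (D : set 'rV[R]_k)
    (b : R) (f : 'rV[R]_k -> R) : Prop :=
  exists C d : R, 0 < d /\ forall x y, D x -> D y -> l1dist x y <= d ->
    `|f x - f y| <= C * l1dist x y `^ b.

Lemma net_mono (R : realType) (k : nat) (T : set 'rV[R]_k) N m n x :
  chaining_nets T N -> (m <= n)%N -> x \in N m -> x \in N n.
Proof.
move=> [_ Nn _ _] /subnKC <-; elim: (n - m)%N => [|j IH] xm; first
    by rewrite addn0.
by rewrite addnS; apply: Nn; exact: IH.
Qed.

(** The deterministic half of chaining: both points descend through the nets to
    level [m], at the cost of a geometric series each, and the two end points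
    are still at a distance comparable to the mesh. *)
Lemma chaining_increment (R : realType) (k : nat) (T : set 'rV[R]_k) N
    (L q : R) (m0 : nat) (f : 'rV[R]_k -> R) :
  chaining_nets T N -> 0 < L -> 0 < q < 1 ->
  (forall m x, T x -> exists2 y, y \in N m & l1dist x y <= L * 2^-1 ^+ m) ->
  (forall m, (m0 <= m)%N -> forall x y, x \in N m.+1 -> y \in N m.+1 ->
    l1dist x y <= (4 * L + 1) * 2^-1 ^+ m -> `|f x - f y| < q ^+ m) ->
  forall m x y, (m0 <= m)%N -> net_points N x -> net_points N y ->
    l1dist x y <= 2^-1 ^+ m ->
    `|f x - f y| <= (2 / (1 - q) + 1) * q ^+ m.
Proof.
move=> netN L0 /andP[q0 q1] NL fq.
have q1' : 0 < 1 - q by rewrite subr_gt0.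
have h2 m : 0 < 2^-1 ^+ m :> R by rewrite exprn_gt0.
have chain j m x : (m0 <= m)%N -> x \in N (m + j)%N -> exists y,
    [/\ y \in N m, l1dist x y <= 2 * L * 2^-1 ^+ m &
        `|f x - f y| <= q ^+ m / (1 - q)].
  elim: j m x => [|j IH] m x m0m.
    rewrite addn0 => xm; exists x; split=> //.
      by rewrite l1distxx mulr_ge0 ?mulr_ge0 ?(ltW L0) ?(ltW (h2 m)).
    by rewrite subrr normr0 divr_ge0 ?exprn_ge0 ?(ltW q0) ?(ltW q1').
  rewrite addnS -addSn => xm.
  have [y' [y'm xy' fxy']] := IH _ _ (leqW m0m) xm.
  have Ty' : T y' by case: netN => + _ _ _; apply; exact: y'm.
  have [y ym yy'] := NL m y' Ty'; exists y; split=> //.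
    apply: (le_trans (l1dist_triangle x y' y)).
    by move: xy' yy'; rewrite exprS; lra.
  have fy : `|f y' - f y| < q ^+ m.
    apply: fq => //; first exact: (net_mono netN (leqnSn m)).
    apply: (le_trans yy'); rewrite ler_pM2r//; lra.
  rewrite (_ : f x - f y = (f x - f y') + (f y' - f y)); last by ring.
  apply: (le_trans (ler_normD _ _)).
  rewrite (_ : q ^+ m / (1 - q) = q ^+ m.+1 / (1 - q) + q ^+ m).
    by apply: lerD => //; exact: ltW.
  by rewrite exprS; field; rewrite gt_eqF.
move=> m x y m0m [i xi] [j yj] xy.
have xm : x \in N (m + (i + j))%N.
  by apply: (net_mono netN _ xi); rewrite addnCA leq_addr.
have ym : y \in N (m + (i + j))%N.
  by apply: (net_mono netN _ yj); rewrite addnA leq_addl.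
have [x' [x'm xx' fx]] := chain _ _ _ m0m xm.
have [y' [y'm yy' fy]] := chain _ _ _ m0m ym.
have fxy : `|f x' - f y'| < q ^+ m.
  apply: fq => //; try exact: (net_mono netN (leqnSn m)).
  have := l1dist_triangle x' x y'; have := l1dist_triangle x y y'.
  by move: xx' yy' xy; rewrite (l1distC x' x); lra.
rewrite (_ : f x - f y = (f x - f x') + (f x' - f y') - (f y - f y')); last
    by ring.
apply: (le_trans (ler_normB _ _)).
apply: (le_trans (lerD (ler_normD _ _) (lexx _))).
by rewrite mulrDl mul1r mulrAC; move: fx fy (ltW fxy); lra.
Qed.

Lemma dyadic_scale (R : realType) (m0 : nat) (r : R) :
  0 < r -> r <= 2^-1 ^+ m0 ->
  exists m, [/\ (m0 <= m)%N, 2^-1 ^+ m.+1 < r & r <= 2^-1 ^+ m].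
Proof.
move=> r0 rm0.
have [n nr] : exists n, 2^-1 ^+ n < r :> R.
  have h : `|2^-1 : R| < 1 by rewrite ger0_norm// invf_lt1// ltr1n.
  have /cvgr0Pnorm_lt/(_ _ r0)[n _ /(_ n (leqnn n))] := cvg_geometric 1 h.
  by rewrite /= mul1r ger0_norm ?exprn_ge0//; exists n.
have [m mr mmin] := ex_minnP (ex_intro (fun n => 2^-1 ^+ n < r) n nr).
case: m mr mmin => [|m] mr mmin.
  have : 2^-1 ^+ m0 <= 1 :> R by rewrite exprn_ile1// invf_le1// ler1n.
  by move: mr; rewrite expr0; move: rm0; lra.
exists m; split=> //.
  rewrite leqNgt; apply/negP => mm0.
  move: mr; rewrite ltNge => /negP; apply; apply: (le_trans rm0).
  by rewrite ler_wiXn2l// ?invf_le1// ?ler1n.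
by rewrite leNgt; apply/negP => /mmin; rewrite ltnn.
Qed.

Section chaining.
Context (dsp : measure_display) (Omega : measurableType dsp) (R : realType)
  (P : probability Omega R).

Lemma prob_bigsetU_le (I : eqType) (s : seq I) (E : I -> set Omega) (c : R) :
  (forall i, measurable (E i)) ->
  (forall i, i \in s -> (P (E i) <= c%:E)%E) ->
  (P (\big[setU/set0]_(i <- s) E i) <= ((size s)%:R * c)%:E)%E.
Proof.
move=> mE; elim: s => [|i s IH] Ec; first by rewrite big_nil measure0 mul0r.
rewrite big_cons; apply: (le_trans (@prob_setU_le _ _ _ P _ _ _ _)) => //.
  by rewrite big_seq; apply: bigsetU_measurable.
rewrite /= -natr1 mulrDl mul1r addrC EFinD; apply: leeD.
  by apply: IH => j js; apply: Ec; rewrite inE js orbT.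
by apply: Ec; rewrite mem_head.
Qed.

(** Comparing the exponential with its monomial of degree [j.+1] turns
    [expR (- (b * r ^+ m))] into a geometric term of ratio [(r ^+ j.+1)^-1],
    and [j] may be taken so large that this beats [2 * B]. *)
Lemma summable_exp_geometric (A B : nat) (b r : R) : 0 < b -> 1 < r ->
  exists C : R, forall m,
    (A * B ^ m)%:R * (2 * expR (- (b * r ^+ m))) <= C * 2^-1 ^+ m.
Proof.
move=> b0 r1; have r0 : 0 < r by exact: lt_trans r1.
have [j jB] : exists j, (2 * B)%:R <= r ^+ j.+1.
  have h : `|r^-1| < 1 by rewrite ger0_norm ?invf_lt1// invr_ge0 ltW.
  have B0 : 0 < (2 * B).+1%:R^-1 :> R by rewrite invr_gt0.
  have /cvgr0Pnorm_lt/(_ _ B0)[n _ /(_ n.+1 (leqnSn n))] := cvg_geometric 1 h.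
  rewrite /= mul1r ger0_norm ?exprn_ge0 ?invr_ge0 ?(ltW r0)// exprVn.
  rewrite ltf_pV2 ?posrE ?exprn_gt0// => /ltW rn; exists n.
  by apply: le_trans rn; rewrite ler_nat.
exists (A%:R * (2 * (j.+1`!%:R / b ^+ j.+1))) => m.
rewrite natrM natrX -!mulrA ler_wpM2l// [leRHS]mulrA [leLHS]mulrCA
    -[leRHS]mulrA.
rewrite ler_wpM2l//.
have y0 : 0 < b * r ^+ m by rewrite mulr_gt0// exprn_gt0.
have ey : expR (- (b * r ^+ m)) <= j.+1`!%:R / (b * r ^+ m) ^+ j.+1.
  rewrite expRN -[leRHS]invrK lef_pV2 ?posrE ?expR_gt0//; last first.
    by rewrite invr_gt0 divr_gt0 ?exprn_gt0// ltr0n fact_gt0.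
  rewrite invf_div; apply: le_trans (expR_ge1Dxn j (ltW y0)).
  by rewrite lerDr.
apply: (@le_trans _ _ (B%:R ^+ m * (j.+1`!%:R / (b * r ^+ m) ^+ j.+1))).
  by rewrite ler_wpM2l ?exprn_ge0.
rewrite exprMn -exprM mulnC exprM.
set X := (r ^+ j.+1) ^+ m; have X0 : 0 < X by rewrite !exprn_gt0.
have bJ0 : 0 < b ^+ j.+1 by rewrite exprn_gt0.
rewrite [leLHS](_ : _ = j.+1`!%:R / b ^+ j.+1 * (B%:R ^+ m / X)); last first.
  by field; rewrite !gt_eqF.
rewrite [leRHS]mulrA ler_wpM2l ?divr_ge0 ?(ltW bJ0)//.
rewrite ler_pdivrMr// exprVn ler_pdivlMl ?exprn_gt0// -exprMn.
by rewrite lerXn2r ?nnegrE ?mulr_ge0 ?exprn_ge0 ?(ltW r0)// -natrM.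
Qed.

Context (k : nat) (T : set 'rV[R]_k) (N : nat -> seq 'rV[R]_k).
Context (U : 'rV[R]_k -> Omega -> R) (K : R).

(** Kolmogorov's continuity theorem on the net points. At level [m] the
    increments are tested against [q ^+ m], where [q] is the [b]-th power of
    one half: as [q] exceeds one half, the threshold is large compared with
    the mesh, and by Borel-Cantelli only finitely many levels are bad. *)
Lemma chaining_hoelder (b : R) : chaining_nets T N -> 0 < K -> 0 < b < 1 ->
  (forall x, measurable_fun setT (U x)) ->
  (forall x y (c t : R), T x -> T y -> 0 < c -> 0 < t -> l1dist x y <= c ->
     (P [set w | (t <= `|U x w - U y w|)%R]
      <= (2 * expR (- (t / (K * c)) ^+ 2))%:E)%E) ->
  {ae P, forall w, locally_hoelder (net_points N) b (fun x => U x w)}.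
Proof.
move=> netN K0 /andP[b0 b1] mU tailU.
have [NT _ [L L0 NL] [A [B NAB]]] := netN.
pose q : R := 2^-1 `^ b.
have q0 : 0 < q by rewrite powR_gt0.
have q1 : q < 1.
  rewrite /q -[ltRHS](_ : 1 `^ b = 1); last by rewrite powR1.
  by apply: gt0_ltr_powR; rewrite ?nnegrE//; lra.
have q2 : 1 < 2 * q.
  rewrite -ltr_pdivrMl// mulr1 /q /powR gt_eqF// -{1}[2^-1]lnK ?posrE//.
  rewrite ltr_expR lnV ?posrE// mulrN ltrN2 gtr_pMl// ln_gt0//; lra.
pose M := 4 * L + 1; have M0 : 0 < M by rewrite /M; lra.
pose E m (p : 'rV[R]_k * 'rV[R]_k) : set Omega :=
  if l1dist p.1 p.2 <= M * 2^-1 ^+ m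
  then [set w | q ^+ m <= `|U p.1 w - U p.2 w|] else set0.
pose pairs m := [seq (x, y) | x <- N m.+1, y <- N m.+1].
pose bad m := \big[setU/set0]_(p <- pairs m) E m p.
have mE m p : measurable (E m p).
  rewrite /E; case: ifP => // _; rewrite -[X in measurable X]setTI.
  have : measurable_fun setT (fun w => U p.1 w - U p.2 w) by exact:
      measurable_funB.
  by move=> /(_ measurableT _ (measurable_norm_ge (q ^+ m))).
have mbad m : measurable (bad m).
  by rewrite /bad big_seq; apply: bigsetU_measurable.
have M2 : 0 < (K * M)^-1 ^+ 2 by rewrite exprn_gt0// invr_gt0 mulr_gt0.
have q4 : 1 < (2 * q) ^+ 2 by rewrite exprn_egt1.
have [C PC] := summable_exp_geometric ((A * B) ^ 2) (B ^ 2) M2 q4.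
have Pbad m : (P (bad m) <= (C / (2 ^ m)%:R)%:E)%E.
  apply: (le_trans (prob_bigsetU_le (c :=
      2 * expR (- ((K * M)^-1 ^+ 2 * ((2 * q) ^+ 2) ^+ m))) _ _)) => //.
    move=> [x y] /allpairsP[[x' y'] /= [xN yN [-> ->]]]; rewrite /E /=.
    case: ifP => xy; last by rewrite measure0 lee_fin mulr_ge0 ?expR_ge0.
    have h2 : 0 < M * 2^-1 ^+ m by rewrite mulr_gt0// exprn_gt0.
    apply: (le_trans (tailU _ _ _ _ (NT _ _ xN) (NT _ _ yN) h2 _ xy)).
      by rewrite exprn_gt0.
    rewrite (_ : q ^+ m / (K * (M * 2^-1 ^+ m)) = (K * M)^-1 * (2 * q) ^+ m).
      by rewrite exprMn -!exprM mulnC.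
    rewrite exprMn exprVn; field.
    by rewrite !gt_eqF// exprn_gt0.
  rewrite lee_fin natrX -exprVn; apply: le_trans (PC m).
  rewrite ler_wpM2r ?mulr_ge0 ?expR_ge0// ler_nat size_allpairs.
  rewrite (_ : (A * B) ^ 2 * (B ^ 2) ^ m = A * B * B ^ m * (A * B * B ^ m))%N;
    last by rewrite mulnn [RHS]expnMn -!expnM (mulnC 2).
  have sN : (size (N m.+1) <= A * B * B ^ m)%N.
    by apply: leq_trans (NAB _) _; rewrite expnS mulnA.
  exact: leq_mul.
have sumbad : (\sum_(m <oo) P (bad m) < +oo)%E.
  apply: (@le_lt_trans _ _ (\sum_(m <oo) (2 * C / (2 ^ (m + 1))%:R)%:E)%E).
    apply: lee_nneseries => // m _; apply: (le_trans (Pbad m)).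
    rewrite lee_fin addn1 expnS natrM invfM le_eqVlt; apply/orP; left.
    by apply/eqP; field; rewrite pnatr_eq0 -lt0n expn_gt0.
  have h := @cvg_geometric_eseries_half R (2 * C) 0.
  by rewrite (cvg_lim _ h)// ltry.
have := lim_sup_set_cvg0 mbad sumbad.
move=> bad0; exists (lim_sup_set bad); split=> //.
  apply: bigcapT_measurable => n; exact: bigcup_measurable.
move=> w /= nh n _ /=; apply: contrapT => nbad; apply: nh.
have good m : (n <= m)%N -> forall x y, x \in N m.+1 -> y \in N m.+1 ->
    l1dist x y <= M * 2^-1 ^+ m -> `|U x w - U y w| < q ^+ m.
  move=> nm x y xN yN xy; rewrite ltNge; apply/negP => Uxy.
  apply: nbad; exists m => //; rewrite /bad -bigcup_seq.
  exists (x, y) => /=; first by apply/allpairsP; exists (x, y).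
  by rewrite /E /= xy.
have q01 : 0 < q < 1 by rewrite q0.
have := chaining_increment netN L0 q01 NL good.
set C' := 2 / (1 - q) + 1 => UC.
have C'0 : 0 <= C' by rewrite addr_ge0// divr_ge0// subr_ge0 ltW.
exists (C' / q), (2^-1 ^+ n); split; first by rewrite exprn_gt0.
move=> x y Nx Ny xyn.
have := l1dist_ge0 x y; rewrite le_eqVlt => /predU1P[xy0|xy0].
  rewrite (l1dist_eq0 (esym xy0)) subrr normr0 mulr_ge0 ?powR_ge0//.
  by rewrite divr_ge0// ltW.
have [m [nm mxy xym]] := dyadic_scale xy0 xyn.
apply: (le_trans (UC m x y nm Nx Ny xym)).
rewrite -mulrA ler_wpM2l// ler_pdivlMl// -exprS.
rewrite /q -powR_mulrn ?powR_ge0// -powRrM mulrC powRrM powR_mulrn//.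
by apply: ge0_ler_powR;
    rewrite ?nnegrE ?exprn_ge0 ?(ltW b0) ?(ltW xy0) ?(ltW mxy).
Qed.

End chaining.

(** * Dyadic nets of a rectangle *)

Lemma leq_expn (m n e : nat) : (m <= n -> m ^ e <= n ^ e)%N.
Proof. by move=> mn; elim: e => // e IH; rewrite !expnS leq_mul. Qed.

Section rectangle_nets.
Context (R : realType) (k : nat) (lo hi x0 : 'rV[R]_k).
Context (lo_lt_hi : forall j, lo 0 j < hi 0 j) (Tx0 : rectangle lo hi x0).

Let grid_point m (f : {ffun 'I_k -> 'I_(2 ^ m).+1}) : 'rV[R]_k :=
  \row_j (lo 0 j + (hi 0 j - lo 0 j) * ((f j)%:R * 2^-1 ^+ m)).

Let grid m : seq 'rV[R]_k := [seq grid_point f | f :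
    {ffun 'I_k -> 'I_(2 ^ m).+1}].

(** The levels are cumulative, which makes them nested. The point [x0] is
    included because the local statements compare the field with its value
    there. *)
Fixpoint rectangle_nets m : seq 'rV[R]_k :=
  if m is m'.+1 then rectangle_nets m' ++ grid m else x0 :: grid 0.

Let grid_in m x : x \in grid m -> rectangle lo hi x.
Proof.
move=> /mapP[f _ ->] j; rewrite mxE.
have hl : 0 < hi 0 j - lo 0 j by rewrite subr_gt0.
have f0 : 0 <= (f j)%:R * 2^-1 ^+ m :> R by rewrite mulr_ge0// exprn_ge0.
have f1 : (f j)%:R * 2^-1 ^+ m <= 1 :> R.
  rewrite exprVn ler_pdivrMr ?exprn_gt0// mul1r -natrX ler_nat.
  by rewrite -ltnS ltn_ord.
rewrite lerDl mulr_ge0 ?(ltW hl)//=.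
by rewrite -lerBrDl -[leRHS]mulr1 ler_pM2l.
Qed.

Let size_grid m : (size (grid m) <= 2 ^ k * (2 * 2 ^ k) ^ m)%N.
Proof.
rewrite size_image card_ffun !card_ord.
apply: (@leq_trans ((2 ^ m.+1) ^ k)).
  by apply: leq_expn; rewrite expnS mul2n -addnn -addn1 leq_add2l expn_gt0.
rewrite -expnM mulSn expnD leq_mul2l; apply/orP; right.
by rewrite mulnC expnM; apply: leq_expn; rewrite leq_pmull.
Qed.

Let grid_approx m x : rectangle lo hi x -> exists2 y, y \in grid m &
  l1dist x y <= (\sum_j (hi 0 j - lo 0 j)) * 2^-1 ^+ m.
Proof.
move=> Tx.
pose z j := (x 0 j - lo 0 j) / (hi 0 j - lo 0 j) * 2 ^+ m.
pose f := [ffun j : 'I_k => (inord (Num.truncn (z j)) : 'I_(2 ^ m).+1)].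
exists (grid_point f); first by apply/mapP; exists f => //; rewrite mem_enum.
rewrite /l1dist mulr_suml; apply: ler_sum => j _.
have hl : 0 < hi 0 j - lo 0 j by rewrite subr_gt0.
have /andP[xl xh] := Tx j.
have m0 : 0 < 2 ^+ m :> R by rewrite exprn_gt0.
have z0 : 0 <= z j.
  by apply: mulr_ge0; rewrite ?(ltW m0)//; apply: divr_ge0;
      rewrite ?subr_ge0// ltW.
have zm : z j <= 2 ^+ m.
  by rewrite /z -[leRHS]mul1r ler_pM2r// ler_pdivrMr// mul1r lerB.
have /andP[tz zt] := truncn_itv z0.
have tm : (Num.truncn (z j) < (2 ^ m).+1)%N.
  by rewrite ltnS -(ler_nat R) natrX (le_trans tz).
rewrite mxE ffunE inordK//.
have -> : x 0 j - (lo 0 j + (hi 0 j - lo 0 j) *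
    ((Num.truncn (z j))%:R * 2^-1 ^+ m)) =
  (hi 0 j - lo 0 j) * 2^-1 ^+ m * (z j - (Num.truncn (z j))%:R).
  by rewrite /z exprVn; field; rewrite !gt_eqF.
have h0 : 0 <= (hi 0 j - lo 0 j) * 2^-1 ^+ m.
  by rewrite mulr_ge0 ?(ltW hl)// exprn_ge0.
rewrite normrM ger0_norm// -[leRHS]mulr1 ler_wpM2l//.
by rewrite ger0_norm ?subr_ge0// -natr1 in zt *; lra.
Qed.

Lemma rectangle_nets_x0 m : x0 \in rectangle_nets m.
Proof.
elim: m => [|m IH]; first by rewrite /= mem_head.
by rewrite /= mem_cat IH.
Qed.

Lemma chaining_rectangle_nets : chaining_nets (rectangle lo hi) rectangle_nets.
Proof.
split.
- elim=> [|m IH] x /=.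
    by rewrite inE => /orP[/eqP ->//|]; exact: grid_in.
  by rewrite mem_cat => /orP[/IH//|]; exact: grid_in.
- by move=> m x xm /=; rewrite mem_cat xm.
- exists (1 + \sum_j (hi 0 j - lo 0 j)).
    rewrite ltr_pwDl// sumr_ge0// => j _.
    by rewrite subr_ge0 ltW.
  move=> m x Tx; have [y ym xy] := grid_approx m Tx; exists y.
    by case: m ym {xy} => [|m] ym /=; rewrite ?inE ?mem_cat ym orbT.
  by apply: (le_trans xy); rewrite ler_pM2r ?exprn_gt0// lerDr.
- exists (2 * 2 ^ k)%N, (2 * 2 ^ k)%N; elim=> [|m IH].
    rewrite /= expn0 muln1; have := size_grid 0; rewrite expn0 muln1 => h.
    have : (0 < 2 ^ k)%N by rewrite expn_gt0.
    move=> k0; rewrite mul2n -addnn; apply: (leq_trans _ (leq_add k0 h)).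
    by rewrite add1n.
  rewrite /= size_cat; apply: (leq_trans (leq_add IH (size_grid m.+1))).
  set b := (2 * 2 ^ k)%N.
  have b2 : (2 <= b)%N by rewrite /b leq_pmulr// expn_gt0.
  rewrite [leqRHS](_ : _ = 2 ^ k * b ^ m.+1 + 2 ^ k * b ^ m.+1)%N; last first.
    by rewrite addnn -mul2n mulnA.
  by rewrite leq_add2r -expnS leq_pmull// expn_gt0.
Qed.

End rectangle_nets.

(** * Countable suprema and density of the nets *)

Lemma bigcup_measurable_countable d (X : measurableType d) (I : choiceType)
    (S : set I) (F : I -> set X) :
  countable S -> (forall i, S i -> measurable (F i)) ->
  measurable (\bigcup_(i in S) F i).
Proof.
move=> /countable_injP[f finj] mF.
rewrite (_ : \bigcup_(i in S) F i =
    \bigcup_n \bigcup_(i in [set i | S i /\ f i = n]) F i); last first.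
  apply/seteqP; split=> t; first by move=> [i Si Fi]; exists (f i) => //;
      exists i.
  by move=> [n _ [i [Si _] Fi]]; exists i.
apply: bigcupT_measurable => n.
have [[i [Si fi]]|nS] := pselect (exists i, S i /\ f i = n).
  rewrite (_ : [set i | _] = [set i]); first by rewrite bigcup_set1; exact: mF.
  apply/seteqP; split=> [j [Sj fj]|_ ->//]; apply: finj; rewrite ?inE//.
  by rewrite fi.
rewrite (_ : [set i | _] = set0) ?bigcup_set0//.
by apply/seteqP; split=> // i Si; apply: nS; exists i.
Qed.

Lemma measurable_ereal_sup_countable d (X : measurableType d) (R : realType)
    (I : choiceType) (S : set I) (h : I -> X -> \bar R) :
  countable S -> (forall i, S i -> measurable_fun setT (h i)) ->
  measurable_fun setT (fun t => ereal_sup [set h i t | i in S]).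
Proof.
move=> cS mh; apply: (measurability _ (ErealGenOInfty.measurableE R)) => //.
move=> _ [_ [x ->] <-]; rewrite setTI.
rewrite (_ : _ @^-1` _ = \bigcup_(i in S) (h i @^-1` `]x%:E, +oo[)); last first.
  apply/seteqP; split=> t /=.
    rewrite in_itv /= andbT => /ereal_sup_gt[_ [i Si <-] xi].
    by exists i => //=; rewrite in_itv /= andbT.
  move=> [i Si] /=; rewrite !in_itv /= !andbT => xi.
  by apply: (lt_le_trans xi); apply: ereal_sup_ubound; exists i.
apply: bigcup_measurable_countable => // i Si.
rewrite -[X in measurable X]setTI; apply: mh => //; exact: emeasurable_itv.
Qed.

Lemma measurable_ereal_inf_countable d (X : measurableType d) (R : realType)
    (I : choiceType) (S : set I) (h : I -> X -> \bar R) :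
  countable S -> (forall i, S i -> measurable_fun setT (h i)) ->
  measurable_fun setT (fun t => ereal_inf [set h i t | i in S]).
Proof.
move=> cS mh.
rewrite (_ : (fun t => _) =
   (fun t => - ereal_sup [set (- h i t) | i in S])%E); last first.
  apply/funext => t; rewrite /ereal_inf; congr (- ereal_sup _)%E.
  by rewrite image_comp.
apply: measurableT_comp => //.
apply: measurable_ereal_sup_countable => // i Si.
by apply: measurableT_comp => //; exact: mh.
Qed.

Lemma countable_net_points (R : realType) (k : nat) (N : nat -> seq 'rV[R]_k) :
  countable (net_points N).
Proof.
rewrite (_ : net_points N = \bigcup_m [set` N m]); last first.
  by apply/seteqP; split=> x [m]; [exists m|move=> _ ?; exists m].
apply: bigcup_countable => // m _; apply: finite_set_countable.
exact: finite_seq.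
Qed.

Lemma l1dist_cvg (R : realType) (k : nat) (u : nat -> 'rV[R]_k) (x : 'rV[R]_k) :
  l1dist (u n) x @[n --> \oo] --> 0 -> u n @[n --> \oo] --> x.
Proof.
move=> ux; apply/cvgrPdist_le => e e0.
have /cvgr0Pnorm_le/(_ _ e0) := ux; apply: filterS => n.
rewrite ger0_norm ?l1dist_ge0// => uxe.
rewrite -[leLHS]/(mx_norm (x - u n)).
have [->|/mx_norm_neq0[[i j] /= ->]] := eqVneq (mx_norm (x - u n)) 0.
  exact: ltW.
rewrite ord1 !mxE; apply: le_trans uxe; rewrite l1distC.
exact: (l1dist_coord x (u n) j).
Qed.

Lemma net_dense (R : realType) (k : nat) (T : set 'rV[R]_k) N x :
  chaining_nets T N -> T x ->
  exists u : nat -> 'rV[R]_k, (forall n, net_points N (u n)) /\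
    l1dist (u n) x @[n --> \oo] --> 0.
Proof.
move=> [NT _ [L L0 NL] _] Tx.
have /choice[u uP] : forall n, exists y, y \in N n /\ l1dist y x <=
    L * 2^-1 ^+ n.
  by move=> n; have [y yN xy] := NL n x Tx; exists y; rewrite l1distC.
exists u; split=> [n|]; first by exists n; case: (uP n).
apply: (@squeeze_cvgr _ _ _ _ (fun=> 0) (fun n => L * 2^-1 ^+ n)).
- by apply: nearW => n; rewrite l1dist_ge0 /=; case: (uP n).
- exact: cvg_cst.
- by apply: cvg_geometric; rewrite ger0_norm// invf_lt1// ltr1n.
Qed.

(** * Moduli of continuity as functionals of countably many values *)

Section scales.
Context (R : realType) (t0 : R) (t0_gt0 : 0 < t0).

Lemma scale_gt0 n : 0 < t0 / n.+1%:R.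
Proof. by rewrite divr_gt0. Qed.

Lemma scale_mono i n : (i <= n)%N -> t0 / n.+1%:R <= t0 / i.+1%:R.
Proof. by move=> ij; rewrite ler_pM2l// lef_pV2 ?posrE// ler_nat. Qed.

Lemma scale_le n : t0 / n.+1%:R <= t0.
Proof. by have := scale_mono (leq0n n); rewrite divr1. Qed.

Lemma exists_scale_lt (r : R) : 0 < r -> exists n, t0 / n.+1%:R < r.
Proof.
move=> r0; have [n] := ltr_add_invr (divr_gt0 r0 t0_gt0); rewrite add0r => nr.
by exists n; rewrite mulrC -ltr_pdivlMr.
Qed.

End scales.

Section net_modulus.
Context (R : realType) (k : nat) (T : set 'rV[R]_k).
Context (m : 'rV[R]_k -> 'rV[R]_k -> R) (psi : R -> R) (t0 : R).
Context (S SD : set ('rV[R]_k * 'rV[R]_k)).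

Definition increment_ratio (f : 'rV[R]_k -> R) (p : 'rV[R]_k * 'rV[R]_k) : R :=
  `|f p.1 - f p.2| / psi (m p.1 p.2).

Let sup_below (f : 'rV[R]_k -> R) n : \bar R :=
  ereal_sup [set (increment_ratio f p)%:E
            | p in [set p | SD p /\ 0 < m p.1 p.2 < t0 / n.+1%:R]].

(** The limit at small scales of the suprema of the increment ratios, expressed
    through the pairs in [SD] only. Suprema over a countable set of pairs keep
    it measurable on the path space. *)
Definition net_modulus (f : 'rV[R]_k -> R) : \bar R :=
  ereal_inf [set ereal_sup [set (increment_ratio f p)%:E
                 | p in [set p | SD p /\ 0 < m p.1 p.2 < t0 / n.+1%:R]]
            | n in [set: nat]].

Context (t0_gt0 : 0 < t0) (psi_gt0 : forall t : R, 0 < t < t0 -> 0 < psi t).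
Context (SDS : SD `<=` S) (ST : forall p, S p -> T p.1 /\ T p.2).

Let below_gt0 := scale_gt0 t0_gt0.
Let below_mono := scale_mono t0_gt0.
Let below_le := scale_le t0_gt0.
Let exists_below := exists_scale_lt t0_gt0.

Let sup_below_mono f i n : (i <= n)%N -> (sup_below f n <= sup_below f i)%E.
Proof.
move=> ij; apply: ereal_sup_le => _ [p [Sp /andP[p0 pn]] <-]; exists p => //.
by split=> //; rewrite p0 (lt_le_trans pn)// below_mono.
Qed.

Lemma net_modulus_ge0 (f : 'rV[R]_k -> R) :
  (forall r : R, 0 < r -> exists p, SD p /\ 0 < m p.1 p.2 < r) ->
  (0 <= net_modulus f)%E.
Proof.
move=> near0; apply: le_ereal_inf_tmp => _ [n _ <-].
have [p [Sp /andP[p0 pn]]] := near0 _ (below_gt0 n).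
apply: (@le_trans _ _ (increment_ratio f p)%:E).
  rewrite lee_fin divr_ge0// ltW// psi_gt0// p0.
  exact: lt_le_trans (below_le n).
by apply: ereal_sup_ubound; exists p => //; split=> //; rewrite p0.
Qed.

(** The suprema decrease with the scale, so their infimum only sees increments
    at arbitrarily small scales, where those of [f - g] are negligible. *)
Lemma net_modulus_le (f g : 'rV[R]_k -> R) :
  (forall e : R, 0 < e -> exists2 r : R, 0 < r &
     forall p, SD p -> 0 < m p.1 p.2 < r ->
       `|(f p.1 - g p.1) - (f p.2 - g p.2)| <= e * psi (m p.1 p.2)) ->
  (net_modulus f <= net_modulus g)%E.
Proof.
move=> fg; apply: le_ereal_inf_tmp => _ [n _ <-]; apply/lee_addgt0Pr => e e0.
have [r r0 fgr] := fg _ e0; have [i ir] := exists_below r0.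
apply: (@le_trans _ _ (sup_below f (maxn i n))).
  by apply: ereal_inf_lbound; exists (maxn i n).
apply: (@le_trans _ _ (sup_below g (maxn i n) + e%:E)%E); last first.
  by apply: leeD => //; exact/sup_below_mono/leq_maxr.
apply: ge_ereal_sup => _ [p [Sp /andP[p0 pn]] <-].
apply: (@le_trans _ _ ((increment_ratio g p)%:E + e%:E)%E); last first.
  by apply: leeD => //; apply: ereal_sup_ubound; exists p => //; split=> //;
      rewrite p0.
have psi0 : 0 < psi (m p.1 p.2).
  by rewrite psi_gt0// p0 (lt_le_trans pn)// below_le.
rewrite -EFinD lee_fin /increment_ratio -[e](mulfK (lt0r_neq0 psi0)) -mulrDl.
rewrite ler_pM2r ?invr_gt0//.
rewrite (_ : f p.1 - f p.2 =
   (g p.1 - g p.2) + ((f p.1 - g p.1) - (f p.2 - g p.2))); last by ring.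
apply: (le_trans (ler_normD _ _)); apply: lerD => //; apply: fgr => //.
by rewrite p0 (lt_trans _ ir)// (lt_le_trans pn)// below_mono// leq_maxl.
Qed.

Lemma measurable_net_modulus : countable SD ->
  measurable_fun [set: path_space R T] (net_modulus : path_space R T -> \bar R).
Proof.
move=> cSD; apply: measurable_ereal_inf_countable; first exact: countableP.
move=> n _; apply: measurable_ereal_sup_countable.
  by apply: sub_countable cSD; apply: subset_card_le => p [].
move=> p [/SDS /ST[T1 T2] _].
apply/measurable_EFinP; apply: measurable_funM => //.
apply: measurableT_comp => //; apply: measurable_funB.
- exact: measurable_eval.
- exact: measurable_eval.
Qed.

Context (psi_cont : forall t : R, 0 < t < t0 ->
  psi x @[x --> t] --> psi t).
Context (m_cont : forall (u v : nat -> 'rV[R]_k) x y,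
  (forall n, T (u n)) -> (forall n, T (v n)) -> T x -> T y ->
  l1dist (u n) x @[n --> \oo] --> 0 -> l1dist (v n) y @[n --> \oo] --> 0 ->
  m (u n) (v n) @[n --> \oo] --> m x y).
Context (S_dense : forall p, S p -> exists u,
  [/\ forall n, SD (u n), l1dist (u n).1 p.1 @[n --> \oo] --> 0 &
      l1dist (u n).2 p.2 @[n --> \oo] --> 0]).

(** For a continuous path the ratio is continuous at pairs of positive distance,
    so a pair in [S] is approximated by pairs in [SD] whose distance satisfies
    a slightly weaker bound. *)
Lemma net_modulus_cvg (f : 'rV[R]_k -> R) : continuous f ->
  ereal_sup [set (increment_ratio f p)%:E
            | p in [set p | S p /\ 0 < m p.1 p.2 <= r]] @[r --> 0^'+]
    --> net_modulus f.
Proof.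
move=> cf; set F := (fun r : R => _).
have Fmono r s : r <= s -> (F r <= F s)%E.
  move=> rs; apply: ereal_sup_le => _ [p [Sp /andP[p0 pr]] <-]; exists p => //.
  by split=> //; rewrite p0 (le_trans pr).
have -> : net_modulus f = ereal_inf (F @` `]0, t0[%classic).
  apply/eqP; rewrite eq_le; apply/andP; split.
    apply: le_ereal_inf_tmp => _ [r rI <-]; move: rI;
        rewrite /= in_itv /= => /andP[r0 rt].
    have [n nr] := exists_below r0.
    apply: (@le_trans _ _ (sup_below f n)).
      by apply: ereal_inf_lbound; exists n.
    apply: ereal_sup_le => _ [p [Sp /andP[p0 pn]] <-]; exists p => //.
    by split; [exact: SDS|rewrite p0 (le_trans (ltW pn))// ltW].
  apply: le_ereal_inf_tmp => _ [n _ <-].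
  have n2 : 0 < t0 / n.+1%:R / 2 by rewrite divr_gt0.
  have n2lt : t0 / n.+1%:R / 2 < t0 / n.+1%:R.
    by rewrite gtr_pMr ?invf_lt1 ?ltr1n// below_gt0.
  apply: (@le_trans _ _ (F (t0 / n.+1%:R / 2))).
    apply: ereal_inf_lbound; exists (t0 / n.+1%:R / 2) => //=.
    by rewrite in_itv /= n2 (lt_le_trans n2lt)// below_le.
  apply: ge_ereal_sup => _ [p [Sp /andP[p0 pn]] <-].
  have [u [Su u1 u2]] := S_dense Sp.
  have [T1 T2] := ST Sp.
  have mu : m (u n).1 (u n).2 @[n --> \oo] --> m p.1 p.2.
    by apply: m_cont => // i; have [] := ST (SDS (Su i)).
  have pt0 : 0 < m p.1 p.2 < t0.
    by rewrite p0 (le_lt_trans pn)// (lt_le_trans n2lt)// below_le.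
  have ru : (increment_ratio f (u n))%:E @[n --> \oo] --> (increment_ratio f
      p)%:E.
    apply: cvg_EFin; first exact: nearW.
    apply: cvgM.
      apply: cvg_norm; apply: cvgB.
        exact: cvg_comp (l1dist_cvg u1) (cf _).
      exact: cvg_comp (l1dist_cvg u2) (cf _).
    apply: cvgV; first by rewrite gt_eqF// psi_gt0.
    exact: cvg_comp mu (psi_cont pt0).
  rewrite -(cvg_lim _ ru)//; apply: lime_le; first exact: (cvgP _ ru).
  have pn' : m p.1 p.2 < t0 / n.+1%:R by exact: le_lt_trans pn n2lt.
  have mu0 : \forall i \near \oo, 0 < m (u i).1 (u i).2.
    by apply: (cvgr_gt _ mu).
  have mun : \forall i \near \oo, m (u i).1 (u i).2 < t0 / n.+1%:R.
    by apply: (cvgr_lt _ mu).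
  near=> i; apply: ereal_sup_ubound; exists (u i) => //; split=> //.
  by apply/andP; split; near: i.
apply: (nondecreasing_at_right_cvge (BLeft t0)).
  by rewrite ltBSide.
by move=> r s _ _; exact: Fmono.
Unshelve. all: by end_near. Qed.

End net_modulus.

(** * Chung's functional of countably many values *)

Section net_chung.
Context (R : realType) (k : nat) (T : set 'rV[R]_k).
Context (x0 : 'rV[R]_k) (mu : 'rV[R]_k -> R) (phi : R -> R) (t0 : R).
Context (D : set 'rV[R]_k).

Definition net_chung_sup (f : 'rV[R]_k -> R) (r : R) : \bar R :=
  ereal_sup [set (`|f x - f x0| / phi r)%:E | x in [set x | D x /\ mu x < r]].

(** Chung's lower limit, expressed through the points in [D] and rational
    radii. *)
Definition net_chung (f : 'rV[R]_k -> R) : \bar R :=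
  ereal_sup [set ereal_inf [set net_chung_sup f (ratr q)
                 | q in [set q : rat | 0 < (ratr q : R) < t0 / n.+1%:R]]
            | n in [set: nat]].

Context (t0_gt0 : 0 < t0) (phi_gt0 : forall t : R, 0 < t < t0 -> 0 < phi t).
Context (DT : D `<=` T) (Dx0 : D x0) (mux0 : mu x0 = 0).

Let below_gt0 := scale_gt0 t0_gt0.
Let below_mono := scale_mono t0_gt0.
Let below_le := scale_le t0_gt0.
Let exists_below := exists_scale_lt t0_gt0.

Let inf_below (f : 'rV[R]_k -> R) n : \bar R :=
  ereal_inf [set net_chung_sup f (ratr q)
            | q in [set q : rat | 0 < (ratr q : R) < t0 / n.+1%:R]].

Let inf_below_mono f i n : (i <= n)%N -> (inf_below f i <= inf_below f n)%E.
Proof.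
move=> ij; apply: ereal_inf_le_tmp => _ [q /andP[q0 qn] <-]; exists q => //=.
by rewrite q0 (lt_le_trans qn)// below_mono.
Qed.

Lemma net_chung_ge0 (f : 'rV[R]_k -> R) :
  (0 <= net_chung f)%E.
Proof.
apply: (@le_trans _ _ (inf_below f 0)); last first.
  by apply: ereal_sup_ubound; exists 0%N.
apply: le_ereal_inf_tmp => _ [q /andP[q0 qn] <-].
apply: ereal_sup_ubound; exists x0; first by split=> //; rewrite mux0.
by rewrite subrr normr0 mul0r.
Qed.

Lemma net_chung_le (f g : 'rV[R]_k -> R) :
  (forall e : R, 0 < e -> exists2 r : R, 0 < r &
     forall q x, 0 < q < r -> D x -> mu x < q ->
       `|(f x - g x) - (f x0 - g x0)| <= e * phi q) ->
  (net_chung f <= net_chung g)%E.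
Proof.
move=> fg; apply: ge_ereal_sup => _ [n _ <-]; apply/lee_addgt0Pr => e e0.
have [r r0 fgr] := fg _ e0; have [i ir] := exists_below r0.
apply: (@le_trans _ _ (inf_below f (maxn i n))).
  exact/inf_below_mono/leq_maxr.
apply: (@le_trans _ _ (inf_below g (maxn i n) + e%:E)%E); last first.
  by apply: leeD => //; apply: ereal_sup_ubound; exists (maxn i n).
rewrite -leeBlDr//; apply: le_ereal_inf_tmp => _ [q /andP[q0 qn] <-].
rewrite leeBlDr//.
apply: (@le_trans _ _ (net_chung_sup f (ratr q))).
  by apply: ereal_inf_lbound; exists q => //=; rewrite q0.
apply: ge_ereal_sup => _ [x [Dx xq] <-].
apply: (@le_trans _ _ ((`|g x - g x0| / phi (ratr q))%:E + e%:E)%E); last first.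
  by apply: leeD => //; apply: ereal_sup_ubound; exists x.
have phi0 : 0 < phi (ratr q).
  by rewrite phi_gt0// q0 (lt_le_trans qn)// below_le.
rewrite -EFinD lee_fin -[e](mulfK (lt0r_neq0 phi0)) -mulrDl.
rewrite ler_pM2r ?invr_gt0//.
rewrite (_ : f x - f x0 =
   (g x - g x0) + ((f x - g x) - (f x0 - g x0))); last by ring.
apply: (le_trans (ler_normD _ _)); apply: lerD => //; apply: fgr => //.
by rewrite q0 (lt_trans _ ir)// (lt_le_trans qn)// below_mono// leq_maxl.
Qed.

Lemma measurable_net_chung : countable D ->
  measurable_fun [set: path_space R T] (net_chung : path_space R T -> \bar R).
Proof.
move=> cD; apply: measurable_ereal_sup_countable; first exact: countableP.
move=> n _; apply: measurable_ereal_inf_countable; first exact: countableP.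
move=> q _; apply: measurable_ereal_sup_countable.
  by apply: sub_countable cD; apply: subset_card_le => x [].
move=> x [/DT Tx _].
apply/measurable_EFinP; apply: measurable_funM => //.
apply: measurableT_comp => //; apply: measurable_funB.
- exact: measurable_eval.
- by apply: measurable_eval; exact: DT.
Qed.

Context (phi_cont : forall t : R, 0 < t < t0 -> phi x @[x --> t] --> phi t).

Let full_chung_sup (f : 'rV[R]_k -> R) (r : R) : \bar R :=
  ereal_sup [set (`|f x - f x0| / phi r)%:E | x in [set x | T x /\ mu x <= r]].

Let net_chung_sup_fin (f : 'rV[R]_k -> R) (r : R) : 0 < r < t0 ->
  net_chung_sup f r != +oo%E -> exists c : R, [/\ 0 <= c,
    net_chung_sup f r = c%:E &
    forall x, D x -> mu x < r -> `|f x - f x0| <= c * phi r].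
Proof.
move=> rt0 Mfin; have r0 : 0 < r by case/andP: rt0.
have M0 : (0 <= net_chung_sup f r)%E.
  apply: ereal_sup_ubound; exists x0; first by split=> //; rewrite mux0.
  by rewrite subrr normr0 mul0r.
move Mc : (net_chung_sup f r) M0 Mfin => M.
case: M Mc => [c||]// Mc; rewrite lee_fin => c0 _.
exists c; split=> // x Dx xr; rewrite -ler_pdivrMr ?phi_gt0// -lee_fin -Mc.
by apply: ereal_sup_ubound; exists x.
Qed.

(** Rational radii suffice: the supremum of the increments is monotone in the
    radius, and the normalization is continuous. *)
Let net_chung_rational (f : 'rV[R]_k -> R) n (r : R) :
  0 < r < t0 / n.+1%:R -> (inf_below f n <= net_chung_sup f r)%E.
Proof.
move=> /andP[r0 rn].
have rt0 : 0 < r < t0 by rewrite r0 (lt_le_trans rn)// below_le.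
have phir := phi_gt0 rt0.
have [->|Mfin] := eqVneq (net_chung_sup f r) +oo%E; first exact: leey.
have [c [c0 -> fx]] := net_chung_sup_fin rt0 Mfin.
have cphi : c * phi r / phi x @[x --> r^'-] --> c.
  rewrite -[X in _ --> X](mulfK (lt0r_neq0 phir)).
  apply: cvgM; first exact: cvg_cst.
  apply: cvgV; first by rewrite gt_eqF.
  by apply: cvg_at_left_filter; exact: phi_cont.
apply/lee_addgt0Pr => e e0; rewrite -EFinD.
have : \forall x \near r^'-, c * phi r / phi x < c + e.
  by apply: (cvgr_lt _ cphi); rewrite ltrDl.
move=> [d /= d0 dP].
have : Num.max 0 (r - d) < r by rewrite gt_max r0 gtrBl.
move=> /rat_in_itvoo[q]; rewrite in_itv /= gt_max => /andP[/andP[q0 qd] qr].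
apply: (@le_trans _ _ (net_chung_sup f (ratr q))).
  by apply: ereal_inf_lbound; exists q => //=; rewrite q0 (lt_trans qr).
apply: ge_ereal_sup => _ [x [Dx xq] <-]; rewrite lee_fin.
have phiq : 0 < phi (ratr q).
  by rewrite phi_gt0// q0 (lt_trans qr)//; case/andP: rt0.
apply: (@le_trans _ _ (c * phi r / phi (ratr q))).
  by rewrite ler_pM2r ?invr_gt0//; apply: fx => //; exact: lt_trans qr.
apply/ltW/dP => //=.
rewrite ger0_norm ?subr_ge0 ?(ltW qr)//; lra.
Qed.

Context (net_closure : forall (f : 'rV[R]_k -> R) (r M : R), continuous f ->
  0 < r -> (forall x, D x -> mu x < r -> `|f x - f x0| <= M) ->
  forall x, T x -> mu x <= r -> `|f x - f x0| <= M).

Let full_chung_supE (f : 'rV[R]_k -> R) (r : R) : continuous f ->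
  0 < r < t0 -> full_chung_sup f r = net_chung_sup f r.
Proof.
move=> cf rt0; apply/eqP; rewrite eq_le; apply/andP; split; last first.
  apply: ereal_sup_le => _ [x [Dx xr] <-]; exists x => //.
  by split; [exact: DT|exact: ltW].
have [->|Mfin] := eqVneq (net_chung_sup f r) +oo%E; first exact: leey.
have [c [c0 -> fx]] := net_chung_sup_fin rt0 Mfin.
apply: ge_ereal_sup => _ [x [Tx xr] <-]; rewrite lee_fin ler_pdivrMr ?phi_gt0//.
by apply: (net_closure cf _ fx) => //; case/andP: rt0.
Qed.

(** The intervals from 0 to [t0 / n.+1] form a basis of right neighborhoods of
    0, and on the first of them the suprema over closed balls of [T] and over
    open balls of [D] coincide for a continuous path. *)
Lemma net_chungE (f : 'rV[R]_k -> R) : continuous f ->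
  limf_einf (full_chung_sup f) 0^'+ = net_chung f.
Proof.
move=> cf; rewrite limf_einfE; apply/eqP; rewrite eq_le; apply/andP; split.
  apply: ge_ereal_sup => _ [V V0 <-].
  have [d /= d0 dV] := V0.
  have [n nd] := exists_below d0.
  apply: (@le_trans _ _ (inf_below f n)); last first.
    by apply: ereal_sup_ubound; exists n.
  apply: le_ereal_inf_tmp => _ [q /andP[q0 qn] <-].
  have qt0 : 0 < (ratr q : R) < t0 by rewrite q0 (lt_le_trans qn)// below_le.
  rewrite -full_chung_supE//; apply: ereal_inf_lbound; exists (ratr q) => //.
  by apply: dV => //=; rewrite sub0r normrN gtr0_norm// (lt_trans qn).
apply: ge_ereal_sup => _ [n _ <-].
apply: (@le_trans _ _ (ereal_inf (full_chung_sup f @` `]0, t0 / n.+1%:R[))).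
  apply: le_ereal_inf_tmp => _ [r rI <-]; rewrite /= in_itv /= in rI.
  rewrite full_chung_supE//; first exact: net_chung_rational.
  by have /andP[-> /= rn] := rI; rewrite (lt_le_trans rn)// below_le.
apply: ereal_sup_ubound; exists `]0, t0 / n.+1%:R[%classic => //.
have : \forall x \near (0 : R)^'+, 0 < x < t0 / n.+1%:R.
  near=> x; apply/andP; split; first by near: x; exact: nbhs_right_gt.
  by near: x; apply: nbhs_right_lt; exact: below_gt0.
by apply: filterS => x; rewrite /= in_itv.
Unshelve. all: by end_near. Qed.

End net_chung.

(** * The anisotropic metric Delta *)

Lemma rectangle_segment (R : realType) (k : nat) (lo hi x y : 'rV[R]_k) (a :
    R) :
  rectangle lo hi x -> rectangle lo hi y -> 0 <= a <= 1 ->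
  rectangle lo hi (\row_j (x 0 j + a * (y 0 j - x 0 j))).
Proof.
move=> Tx Ty /andP[a0 a1] j; rewrite mxE.
have /andP[xl xh] := Tx j; have /andP[yl yh] := Ty j.
have b0 : 0 <= 1 - a by rewrite subr_ge0.
apply/andP; split; rewrite -subr_ge0.
  rewrite (_ : _ - _ = (1 - a) * (x 0 j - lo 0 j) + a * (y 0 j - lo 0 j)).
    by rewrite addr_ge0// mulr_ge0// subr_ge0.
  by ring.
rewrite (_ : _ - _ = (1 - a) * (hi 0 j - x 0 j) + a * (hi 0 j - y 0 j)).
  by rewrite addr_ge0// mulr_ge0// subr_ge0.
by ring.
Qed.

Section pseudometric.
Context (R : realType) (k : nat) (T : set 'rV[R]_k).
Context (m : 'rV[R]_k -> 'rV[R]_k -> R).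
Context (mC : forall x y, m x y = m y x).
Context (m_triangle : forall x y z, T x -> T y -> T z -> m x z <=
    m x y + m y z).
Context (m_small : forall (u : nat -> 'rV[R]_k) x, (forall n, T (u n)) -> T x ->
  l1dist (u n) x @[n --> \oo] --> 0 -> m (u n) x @[n --> \oo] --> 0).

Lemma pseudometric_cvg (u v : nat -> 'rV[R]_k) x y :
  (forall n, T (u n)) -> (forall n, T (v n)) -> T x -> T y ->
  l1dist (u n) x @[n --> \oo] --> 0 -> l1dist (v n) y @[n --> \oo] --> 0 ->
  m (u n) (v n) @[n --> \oo] --> m x y.
Proof.
move=> Tu Tv Tx Ty ux vy.
have h : m (u n) x + m (v n) y @[n --> \oo] --> 0 + 0.
  by apply: cvgD; exact: m_small.
rewrite addr0 in h.
have h' : m x y - (m (u n) x + m (v n) y) @[n --> \oo] --> m x y - 0.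
  by apply: cvgB => //; exact: cvg_cst.
have h'' : m x y + (m (u n) x + m (v n) y) @[n --> \oo] --> m x y + 0.
  by apply: cvgD => //; exact: cvg_cst.
rewrite subr0 in h'; rewrite addr0 in h''.
apply: (squeeze_cvgr _ h' h''); apply: nearW => n.
have := m_triangle (Tu n) Tx (Tv n); have := m_triangle Tx Ty (Tv n).
have := m_triangle Tx (Tu n) Ty; have := m_triangle (Tu n) (Tv n) Ty.
rewrite (mC y (v n)) (mC x (u n)) => h1 h2 h3 h4.
apply/andP; split; lra.
Qed.

End pseudometric.

(** Each of [s] and [t] is a fraction of [s + t], and a number between 0 and 1
    is at most its power of exponent [a <= 1]. *)
Lemma powR_subadditive (R : realType) (a s t : R) : 0 < a <= 1 -> 0 <= s ->
  0 <= t -> (s + t) `^ a <= s `^ a + t `^ a.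
Proof.
move=> /andP[a0 a1]; rewrite le_eqVlt => /predU1P[<-|s0] t0.
  by rewrite add0r lerDr powR_ge0.
have st0 : 0 < s + t by rewrite ltr_pwDl.
have part x : 0 <= x -> x <= s + t -> x / (s + t) * (s + t) `^ a <= x `^ a.
  move=> x0 xst.
  have -> : x `^ a = (x / (s + t)) `^ a * (s + t) `^ a.
    rewrite -powRM ?divr_ge0 ?(ltW st0)//.
    by rewrite divfK// gt_eqF.
  rewrite ler_wpM2r ?powR_ge0//.
  have [->|xn0] := eqVneq x 0; first by rewrite mul0r powR_ge0.
  have {xn0}x0 : 0 < x by rewrite lt_def xn0.
  by apply: ger1_powR => //; rewrite divr_gt0//= ler_pdivrMr// mul1r.
have -> : (s + t) `^ a =
    s / (s + t) * (s + t) `^ a + t / (s + t) * (s + t) `^ a.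
  by rewrite -mulrDl -mulrDl divff ?mul1r// gt_eqF.
by apply: lerD; apply: part; rewrite ?(ltW s0)// ?lerDl ?lerDr// ltW.
Qed.

Lemma powR_small (R : realType) (a e : R) : 0 < a -> 0 < e ->
  exists2 d, 0 < d & forall t, 0 <= t <= d -> t `^ a <= e.
Proof.
move=> a0 e0; exists (e `^ a^-1); first exact: powR_gt0.
move=> t /andP[t0 td].
have -> : e = (e `^ a^-1) `^ a by rewrite -powRrM mulVf ?gt_eqF// powRr1// ltW.
by apply: ge0_ler_powR; rewrite ?nnegrE ?powR_ge0 ?(ltW a0).
Qed.

Lemma positive_lower_bound (R : realType) (k : nat) (g : 'I_k -> R) :
  (forall j, 0 < g j) -> exists2 c, 0 < c & forall j, c <= g j.
Proof.
move=> g0; exists (\big[Num.min/1]_j g j).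
  by apply/bigmin_gtP; split.
by move=> j; exact: bigmin_le_cond.
Qed.

Section Delta.
Context (R : realType) (k : nat) (gamma : 'I_k -> R).
Context (gamma_gt0 : forall j, 0 < gamma j).
Implicit Types x y z : 'rV[R]_k.

Let alpha01 j : 0 < alpha gamma j < 1.
Proof.
have := gamma_gt0 j; rewrite /alpha => g0.
by rewrite invr_gt0 invf_lt1 ?addr_gt0//= ltrDr g0.
Qed.

Let alpha_gt0 j : 0 < alpha gamma j. Proof. by case/andP: (alpha01 j). Qed.

Lemma Delta_ge0 x y : 0 <= Delta gamma x y.
Proof. by apply: sumr_ge0 => j _; exact: powR_ge0. Qed.

Lemma DeltaC x y : Delta gamma x y = Delta gamma y x.
Proof. by apply: eq_bigr => j _; rewrite distrC. Qed.

Lemma Deltaxx x : Delta gamma x x = 0.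
Proof.
apply: big1 => j _; rewrite subrr normr0 powR0//.
by rewrite gt_eqF// alpha_gt0.
Qed.

Lemma Delta_triangle x y z :
  Delta gamma x z <= Delta gamma x y + Delta gamma y z.
Proof.
rewrite /Delta -big_split /=; apply: ler_sum => j _.
have /andP[a0 a1] := alpha01 j.
apply: (@le_trans _ _ ((`|x 0 j - y 0 j| + `|y 0 j - z 0 j|) `^ alpha gamma j)).
  apply: ge0_ler_powR; rewrite ?nnegrE ?addr_ge0 ?(ltW a0)//.
  by rewrite (_ : x 0 j - z 0 j = (x 0 j - y 0 j) + (y 0 j - z 0 j))
      ?ler_normD//; ring.
by apply: powR_subadditive => //; rewrite a0 ltW.
Qed.

Lemma Delta_small (u : nat -> 'rV[R]_k) x :
  l1dist (u n) x @[n --> \oo] --> 0 -> Delta gamma (u n) x @[n --> \oo] --> 0.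
Proof.
move=> ux; rewrite /Delta.
rewrite -[X in _ --> X](_ : \sum_(j < k) (0 : R) = 0); last by rewrite big1.
apply: cvg_big => [|j _]; first exact: add_continuous.
apply/cvgr0Pnorm_le => e e0.
have [d d0 dP] := powR_small (alpha_gt0 j) e0.
have /cvgr0Pnorm_le/(_ _ d0) := ux; apply: filterS => n.
rewrite ger0_norm ?l1dist_ge0// [X in _ -> X <= _]ger0_norm ?powR_ge0// => ud.
apply: dP.
by rewrite normr_ge0 (le_trans (l1dist_coord _ _ _)).
Qed.

(** The exponents [(alpha gamma j)^-1 = 1 + gamma j] are bounded away from one.
    A field that is Lipschitz for the l1 distance is therefore negligible
    against Delta at small scales. *)
Lemma l1dist_le_Delta : exists C g r : R, [/\ 0 <= C, 0 < g, 0 < r &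
  forall x y, Delta gamma x y < r ->
    l1dist x y <= C * Delta gamma x y `^ (1 + g)].
Proof.
have [g g0 gP] := positive_lower_bound gamma_gt0.
exists k%:R, g, 1; split=> // x y D1.
rewrite /l1dist -[k in k%:R]card_ord -sum1_card natr_sum mulr_suml.
apply: ler_sum => j _; rewrite mul1r.
set a := `|_|; have a0 : 0 <= a by exact: normr_ge0.
have aD : a `^ alpha gamma j <= Delta gamma x y.
  by rewrite /Delta (bigD1 j)//= lerDl; apply: sumr_ge0 => i _; exact: powR_ge0.
have [D0|Dn0] := eqVneq (Delta gamma x y) 0.
  rewrite D0 powR0 ?gt_eqF ?addr_gt0//; move: aD; rewrite D0 => aD.
  suff -> : a = 0 by [].
  apply: (@powR_eq0_eq0 _ _ (alpha gamma j)); apply/eqP.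
  by rewrite eq_le aD powR_ge0.
have D0 : 0 < Delta gamma x y by rewrite lt_def Dn0 Delta_ge0.
have gj0 : 0 < gamma j + 1 by rewrite addr_gt0.
have -> : a = (a `^ alpha gamma j) `^ (gamma j + 1).
  by rewrite -powRrM /alpha mulVf ?gt_eqF// powRr1.
apply: (@le_trans _ _ (Delta gamma x y `^ (gamma j + 1))).
  by apply: ge0_ler_powR; rewrite ?nnegrE ?powR_ge0 ?Delta_ge0 ?(ltW gj0).
by apply: ger_powR; [rewrite D0 ltW|rewrite addrC lerD2r].
Qed.

Context (lo hi x0 : 'rV[R]_k) (Tx0 : rectangle lo hi x0).

(** A point of the closed ball of Delta is a limit of points of the open ball,
    reached by moving towards the center inside of the convex rectangle; the
    open ball is open, so its points are limits of net points in it. *)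
Lemma Delta_ball_closure (N : nat -> seq 'rV[R]_k)
    (f : 'rV[R]_k -> R) (r M : R) :
  chaining_nets (rectangle lo hi) N -> continuous f -> 0 < r ->
  (forall x, net_points N x -> Delta gamma x x0 < r -> `|f x - f x0| <= M) ->
  forall x, rectangle lo hi x -> Delta gamma x x0 <= r -> `|f x - f x0| <= M.
Proof.
move=> netN cf r0 fM.
have limM (u : nat -> 'rV[R]_k) x : l1dist (u n) x @[n --> \oo] --> 0 ->
    (\forall n \near \oo, `|f (u n) - f x0| <= M) -> `|f x - f x0| <= M.
  move=> ux uM.
  have fu : `|f (u n) - f x0| @[n --> \oo] --> `|f x - f x0|.
    apply: cvg_norm; apply: cvgB; last exact: cvg_cst.
    exact: cvg_comp (l1dist_cvg ux) (cf _).
  rewrite -(cvg_lim _ fu)//; apply: limr_le => //; exact: (cvgP _ fu).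
have NT x : net_points N x -> rectangle lo hi x.
  by move=> [n xn]; have [+ _ _ _] := netN; apply; exact: xn.
have openM x : rectangle lo hi x -> Delta gamma x x0 < r -> `|f x - f x0| <= M.
  move=> Tx xr; have [u [Nu ux]] := net_dense netN Tx; apply: (limM u) => //.
  have := @pseudometric_cvg _ _ (rectangle lo hi) _ DeltaC
    (fun x y z _ _ _ => Delta_triangle x y z) (fun u x _ _ => @Delta_small u x)
    u (fun=> x0) x x0 (fun n => NT _ (Nu n)) (fun=> Tx0) Tx Tx0 ux.
  move=> /(_ _)/cvgr_lt H.
  have : \forall n \near \oo, Delta gamma (u n) x0 < r.
    apply: H => //.
    rewrite (_ : (fun n => _) = (fun=> 0)); first exact: cvg_cst.
    by apply/funext => n; rewrite l1distxx.
  by apply: filterS => n unr; apply: fM.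
move=> x Tx xr.
pose s n : R := 1 - n.+2%:R^-1.
have s01 n : 0 < s n < 1.
  by rewrite /s subr_gt0 invf_lt1// ltr1n /= ltrBlDr ltrDl invr_gt0.
pose y n : 'rV[R]_k := \row_j (x0 0 j + s n * (x 0 j - x0 0 j)).
apply: (limM y).
  have -> : (fun n => l1dist (y n) x) = (fun n => l1dist x0 x * n.+2%:R^-1).
    apply/funext => n; rewrite /l1dist mulr_suml; apply: eq_bigr => j _.
    have n2 : 0 <= n.+2%:R^-1 :> R by rewrite invr_ge0.
    rewrite mxE -[X in _ = _ * X]ger0_norm// -normrM; congr `|_|.
    by rewrite /s; ring.
  rewrite -[X in _ --> X](mulr0 (l1dist x0 x)); apply: cvgM; first exact:
      cvg_cst.
  have := @cvg_harmonic R; rewrite -cvg_shiftS; exact.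
apply: nearW => n; have /andP[s0 s1] := s01 n; apply: openM.
  by apply: rectangle_segment; rewrite // (ltW s0) (ltW s1).
have [a a0 aP] := positive_lower_bound alpha_gt0.
have yx : Delta gamma (y n) x0 <= s n `^ a * Delta gamma x x0.
  rewrite mulr_sumr; apply: ler_sum => j _.
  rewrite mxE (_ : x0 0 j + s n * (x 0 j - x0 0 j) - x0 0 j
    = s n * (x 0 j - x0 0 j)); last by ring.
  rewrite normrM powRM ?normr_ge0// (ger0_norm (ltW s0)).
  by rewrite ler_wpM2r ?powR_ge0//; apply: ger_powR => //; rewrite s0 ltW.
apply: (le_lt_trans yx).
have [->|Dn0] := eqVneq (Delta gamma x x0) 0; first by rewrite mulr0.
apply: lt_le_trans xr; rewrite gtr_pMl ?lt_def ?Dn0 ?Delta_ge0//.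
rewrite -lt_def -[ltRHS](_ : 1 `^ a = 1); last by rewrite powR1.
by apply: gt0_ltr_powR; rewrite ?nnegrE// ltW.
Qed.

End Delta.

(** * Gauge functions and the gain of regularity *)

Section normalizations.
Context (R : realType).

(** Below this scale the iterated logarithm of the inverse exceeds one, so that
    all gauges are positive and continuous and the moduli dominate the
    identity. *)
Definition loglog_scale : R := expR (- expR 1).

Lemma loglog_scale_gt0 : 0 < loglog_scale.
Proof. exact: expR_gt0. Qed.

Lemma lnV_gt (t : R) : 0 < t < loglog_scale -> expR 1 < ln t^-1.
Proof.
move=> /andP[t0 tl]; rewrite lnV ?posrE// ltrNr -ltr_expR lnK ?posrE//.
Qed.

Lemma lnV_gt1 (t : R) : 0 < t < loglog_scale -> 1 < ln t^-1.
Proof. by move=> /lnV_gt; apply: lt_trans; rewrite expR_gt1. Qed.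

Lemma lnlnV_gt1 (t : R) : 0 < t < loglog_scale -> 1 < ln (ln t^-1).
Proof.
move=> tl; have h := lnV_gt tl; have h1 := lnV_gt1 tl.
by rewrite -ltr_expR lnK// posrE (lt_trans _ h1).
Qed.

Lemma lnV_cvg (t : R) : 0 < t -> ln x^-1 @[x --> t] --> ln t^-1.
Proof.
move=> t0; apply: (@cvg_comp _ _ _ (fun x => x^-1) (@ln R) _ (nbhs t^-1)).
  by apply: cvgV => //; rewrite gt_eqF.
by apply: continuous_ln; rewrite invr_gt0.
Qed.

Lemma lnlnV_cvg (t : R) : 0 < t < loglog_scale ->
  ln (ln x^-1) @[x --> t] --> ln (ln t^-1).
Proof.
move=> tl; have t0 : 0 < t by case/andP: tl.
have l0 : 0 < ln t^-1 by rewrite (lt_trans _ (lnV_gt1 tl)).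
exact: cvg_comp (lnV_cvg t0) (continuous_ln l0).
Qed.

Definition lil_gauge (t : R) : R := t * Num.sqrt (ln (ln t^-1)).
Definition uniform_gauge (t : R) : R := t * Num.sqrt (ln t^-1).

Let ge_of_sqrt (t s : R) : 0 < t -> 1 < s -> t <= t * Num.sqrt s.
Proof.
move=> t0 s1; rewrite ler_peMr ?(ltW t0)// -[leLHS]sqrtr1.
by apply: ler_wsqrtr; exact: ltW.
Qed.

Lemma lil_gauge_ge (t : R) : 0 < t < loglog_scale -> t <= lil_gauge t.
Proof.
by move=> tl; apply: ge_of_sqrt; [case/andP: tl|exact: lnlnV_gt1].
Qed.

Lemma uniform_gauge_ge (t : R) : 0 < t < loglog_scale -> t <= uniform_gauge t.
Proof.
by move=> tl; apply: ge_of_sqrt; [case/andP: tl|exact: lnV_gt1].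
Qed.

Lemma lil_gauge_cvg (t : R) : 0 < t < loglog_scale ->
  lil_gauge x @[x --> t] --> lil_gauge t.
Proof.
move=> tl; apply: cvgM; first exact: cvg_id.
exact: cvg_comp (lnlnV_cvg tl) (@sqrt_continuous R _).
Qed.

Lemma uniform_gauge_cvg (t : R) : 0 < t < loglog_scale ->
  uniform_gauge x @[x --> t] --> uniform_gauge t.
Proof.
move=> /andP[t0 _]; apply: cvgM; first exact: cvg_id.
exact: cvg_comp (lnV_cvg t0) (@sqrt_continuous R _).
Qed.

Definition chung_gauge (Q t : R) : R := t * ln (ln t^-1) `^ (- Q^-1).

Lemma chung_gauge_gt0 (Q t : R) : 0 < t < loglog_scale -> 0 < chung_gauge Q t.
Proof.
move=> tl; rewrite mulr_gt0//; first by case/andP: tl.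
by rewrite powR_gt0// (lt_trans _ (lnlnV_gt1 tl)).
Qed.

Lemma chung_gauge_cvg (Q t : R) : 0 < t < loglog_scale ->
  chung_gauge Q x @[x --> t] --> chung_gauge Q t.
Proof.
move=> tl; apply: cvgM; first exact: cvg_id.
have l0 : 0 < ln (ln t^-1) by rewrite (lt_trans _ (lnlnV_gt1 tl)).
have h : expR (- Q^-1 * ln (ln (ln x^-1))) @[x --> t] -->
    expR (- Q^-1 * ln (ln (ln t^-1))).
  apply: continuous_cvg; first exact: continuous_expR.
  apply: cvgM; first exact: cvg_cst.
  exact: cvg_comp (lnlnV_cvg tl) (continuous_ln l0).
rewrite {2}/powR gt_eqF//; apply: cvg_trans h; apply: near_eq_cvg.
have : \forall x \near t, 0 < ln (ln x^-1) by apply: (cvgr_gt _ (lnlnV_cvg tl)).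
by apply: filterS => x lx; rewrite /powR gt_eqF.
Qed.

Lemma ln_le_powR (h y : R) : 0 < h -> 1 < y -> ln y <= h^-1 * y `^ h.
Proof.
move=> h0 y1; have y0 : 0 < y by rewrite (lt_trans _ y1).
rewrite ler_pdivlMl// -ln_powR.
have yh : 0 < y `^ h by rewrite powR_gt0.
have := expR_ge1Dx (ln (y `^ h)); rewrite lnK ?posrE//; lra.
Qed.

(** Half of the gain [h] absorbs the iterated logarithm, the other half tends to
    0; as [1 <= Q], the power [Q^-1] of the iterated logarithm is at most its
    first power. *)
Lemma powR_le_chung_gauge (Q h C e : R) : 1 <= Q -> 0 < h -> 0 <= C -> 0 < e ->
  exists2 r, 0 < r & forall t, 0 < t < r -> C * t `^ (1 + h) <=
      e * chung_gauge Q t.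
Proof.
move=> Q1 h0 C0 e0; have h20 : 0 < h / 2 by rewrite divr_gt0.
have C1 : 0 < C * (h / 2)^-1 + 1.
  by rewrite ltr_wpDl// mulr_ge0// invr_ge0 ltW.
have [d d0 dP] := powR_small h20 (divr_gt0 e0 C1).
exists (Num.min d loglog_scale); first by rewrite lt_min d0 loglog_scale_gt0.
move=> t /andP[t0]; rewrite lt_min => /andP[td tl].
have tls : 0 < t < loglog_scale by rewrite t0.
have ll1 := lnlnV_gt1 tls; have l1 := lnV_gt1 tls.
have ll0 : 0 < ln (ln t^-1) by exact: lt_trans ll1.
have th : 0 < t `^ (h / 2) by exact: powR_gt0.
rewrite /chung_gauge powRN mulrA ler_pdivlMr ?powR_gt0//.
have l_le : ln (ln t^-1) `^ Q^-1 <= (h / 2)^-1 * (t `^ (h / 2))^-1.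
  apply: (@le_trans _ _ (ln (ln t^-1))).
    by apply: ler1_powR; [exact: ltW|rewrite invf_le1 ?(lt_le_trans _ Q1)].
  apply: (@le_trans _ _ (ln t^-1)).
    have := expR_ge1Dx (ln (ln t^-1)); rewrite lnK ?posrE ?(lt_trans _ l1)//.
    lra.
  have t1 : 1 < t^-1.
    by rewrite -ltr_ln ?posrE ?invr_gt0// ln1 (lt_trans _ l1).
  apply: (le_trans (ln_le_powR h20 t1)).
  by rewrite -(powR_inv1 (ltW t0)) -powRrM mulN1r powRN.
have -> : t `^ (1 + h) = t * t `^ (h / 2) * t `^ (h / 2).
  have -> : 1 + h = 1 + h / 2 + h / 2 by lra.
  by rewrite !powRD ?(gt_eqF t0) ?implybT// powRr1// ltW.
apply: (@le_trans _ _ (C * (t * t `^ (h / 2) * t `^ (h / 2)) *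
    ((h / 2)^-1 * (t `^ (h / 2))^-1))).
  by rewrite ler_wpM2l// !mulr_ge0// ltW.
rewrite [leLHS](_ : _ = t * (t `^ (h / 2) * (C * (h / 2)^-1))); last first.
  by field; rewrite !gt_eqF.
rewrite [leRHS]mulrC ler_pM2l//.
have := dP t; rewrite (ltW t0) (ltW td) => /(_ isT).
rewrite ler_pdivlMr// => /(le_trans _); apply.
by rewrite ler_pM2l// lerDl.
Qed.

Lemma powR_le_linear (h C e : R) : 0 < h -> 0 <= C -> 0 < e ->
  exists2 r, 0 < r & forall t, 0 < t < r -> C * t `^ (1 + h) <= e * t.
Proof.
move=> h0 C0 e0.
have C1 : 0 < C + 1 by rewrite ltr_wpDl.
have [d d0 dP] := powR_small h0 (divr_gt0 e0 C1).
exists d => // t /andP[t0 td]; rewrite powRD ?gt_eqF ?implybT ?addr_gt0//.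
rewrite powRr1 ?(ltW t0)// mulrCA [leRHS]mulrC ler_pM2l//.
have := dP t; rewrite (ltW t0) (ltW td) => /(_ isT).
rewrite ler_pdivlMr// mulrC => /(le_trans _); apply.
by rewrite ler_wpM2r ?powR_ge0// lerDl.
Qed.

End normalizations.

Lemma Qdim_ge1 (R : realType) (k : nat) (gamma : 'I_k -> R) : (1 <= k)%N ->
  (forall j, 0 < gamma j) -> 1 <= Qdim gamma.
Proof.
case: k gamma => // k gamma _ g0; rewrite /Qdim big_ord_recl /alpha invrK.
rewrite -addrA addrCA lerDl addr_ge0 ?(ltW (g0 _))//.
by apply: sumr_ge0 => j _; rewrite invrK addr_ge0// ltW.
Qed.

(** The exponent [(1 + g / 2) / (1 + g)] is below one, hence available for
    Gaussian fields that are Lipschitz in L2, and its product with [1 + g] is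
    still above one. *)
Lemma locally_hoelder_gain (R : realType) (k : nat) (T D : set 'rV[R]_k)
    (m : 'rV[R]_k -> 'rV[R]_k -> R) (f : 'rV[R]_k -> R) (C g r : R) :
  D `<=` T -> (forall x y, 0 <= m x y) -> 0 <= C -> 0 < g -> 0 < r ->
  (forall x y, T x -> T y -> m x y < r -> l1dist x y <= C * m x y `^ (1 + g)) ->
  locally_hoelder D ((1 + g / 2) / (1 + g)) f ->
  exists C' r' : R, [/\ 0 <= C', 0 < r' & forall x y, D x -> D y ->
    m x y < r' -> `|f x - f y| <= C' * m x y `^ (1 + g / 2)].
Proof.
move=> DT m0 C0 g0 r0 lm [K [d [d0 fK]]].
set b := (1 + g / 2) / (1 + g) in fK.
have g1 : 0 < 1 + g by rewrite addr_gt0.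
have b0 : 0 < b by rewrite divr_gt0// addr_gt0// divr_gt0.
have C1 : 0 < C + 1 by rewrite ltr_wpDl.
have [e e0 eP] := powR_small g1 (divr_gt0 d0 C1).
exists (`|K| * C `^ b), (Num.min r e); split; first
    by rewrite mulr_ge0 ?powR_ge0.
  by rewrite lt_min r0.
move=> x y Dx Dy; rewrite lt_min => /andP[mr me].
have lxy := lm x y (DT _ Dx) (DT _ Dy) mr.
have ld : l1dist x y <= d.
  apply: (le_trans lxy); have := eP (m x y).
  rewrite m0 (ltW me) => /(_ isT); rewrite ler_pdivlMr// mulrC.
  by move/(le_trans _); apply; rewrite ler_wpM2r ?powR_ge0// lerDl.
apply: (le_trans (fK x y Dx Dy ld)).
apply: (@le_trans _ _ (`|K| * l1dist x y `^ b)).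
  by rewrite ler_wpM2r ?powR_ge0// ler_norm.
rewrite -mulrA ler_wpM2l//.
have -> : C `^ b * m x y `^ (1 + g / 2) = (C * m x y `^ (1 + g)) `^ b.
  rewrite powRM ?powR_ge0// -powRrM /b; congr (_ * _ `^ _).
  by field; rewrite gt_eqF.
by apply: ge0_ler_powR;
    rewrite ?nnegrE ?l1dist_ge0 ?(ltW b0) ?mulr_ge0 ?powR_ge0.
Qed.

(** * Low and high frequencies of the field *)

Lemma centered_gaussian_ae (dsp : measure_display)
    (Omega : measurableType dsp) (R : realType) (P : probability Omega R)
    (X Y : Omega -> R) : measurable_fun setT X -> measurable_fun setT Y ->
  {ae P, forall w, X w = Y w} -> centered_gaussian P X -> centered_gaussian P Y.
Proof.
move=> mX mY XY [s s0 XE]; exists s => // B mB; rewrite -(XE B mB).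
apply: ae_iff_prob.
- by rewrite -[X in measurable X]setTI; exact: mY.
- by rewrite -[X in measurable X]setTI; exact: mX.
- by apply: filterS XY => w XYw; rewrite /preimage /= XYw.
Qed.

Section frequency_split.
Context (dsp : measure_display) (Omega : measurableType dsp) (R : realType)
  (P : probability Omega R) (k : nat) (v : 'rV[R]_k -> {RV P >-> R})
  (T : set 'rV[R]_k) (gamma : 'I_k -> R)
  (W : set R -> 'rV[R]_k -> {RV P >-> R}).
Context (W_gaussian : centered_gaussian_field
    [set p : set R * 'rV[R]_k | borel_nonneg p.1 /\ T p.2]
    (fun p => W p.1 p.2))
  (W_scattered : forall x, T x -> independently_scattered (fun A => W A x))
  (W_total : forall x, T x -> {ae P, forall w, W (@nonneg R) x w = v x w})
  (W_independent : forall A B, borel_nonneg A -> borel_nonneg B ->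
     A `&` B = set0 -> independent_processes T (W A) (W B)).

Definition low_frequency (n : nat) (x : 'rV[R]_k) : {RV P >-> R} :=
  W (ico 0 n%:R%:E) x.
Definition high_frequency (n : nat) (x : 'rV[R]_k) : {RV P >-> R} :=
  W (ico n%:R +oo%E) x.

Lemma low_high_independent n :
  independent_processes T (low_frequency n) (high_frequency n).
Proof.
apply: W_independent; [exact: borel_nonneg_ico|exact: borel_nonneg_ico|].
exact: ico_disjoint.
Qed.

Lemma low_frequency_cvg x (e : R) : T x -> 0 < e ->
  P [set w | e <= `|low_frequency n x w - v x w|] @[n --> \oo] --> 0%E.
Proof.
move=> Tx e0; have h := scattered_ico_cvg (W_scattered Tx).
apply/fine_cvgP; split.
  apply: nearW => n; apply: fin_num_measure.
  rewrite -[[set w | _]]/((fun w => low_frequency n x w - v x w) @^-1`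
    [set z | e <= `|z|]) -[X in measurable X]setTI.
  have : measurable_fun setT (fun w => low_frequency n x w - v x w) by exact:
      measurable_funB.
  by apply => //; exact: measurable_norm_ge.
have /fine_cvgP[hf hc] := h.
apply/cvgr0Pnorm_le => d d0.
have ed0 : 0 < e * Num.sqrt d by rewrite mulr_gt0// sqrtr_gt0.
have {hc}/cvgr0Pnorm_le/(_ _ ed0) hc := hc.
apply: filterS2 hf hc => n Xfin Xsmall.
set X := fun w => W (@nonneg R) x w - W (ico 0 n%:R%:E) x w.
have mX : measurable_fun setT X by exact: measurable_funB.
have mY : measurable_fun setT (fun w => low_frequency n x w - v x w).
  exact: measurable_funB.
have XE : L2norm P (fun w => low_frequency n x w - v x w) = L2norm P X.
  rewrite -(L2normN P X); apply: L2norm_ae => //; first exact: measurableT_comp.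
  by apply: filterS (W_total Tx) => w <-; rewrite /X opprB.
set c := fine (L2norm P X).
have c0 : 0 <= c by rewrite fine_ge0// L2norm_ge0.
have cE : (L2norm P (fun w => (low_frequency n x w - v x w)%R) <= c%:E)%E.
  by rewrite XE fineK.
have := L2norm_chebyshev mY cE e0.
set p := P _ => pc.
have p0 : (0 <= p)%E by exact: measure_ge0.
have cd : c <= e * Num.sqrt d.
  by rewrite -[c]ger0_norm.
rewrite /= ger0_norm ?fine_ge0// -lee_fin fineK; last first.
  by rewrite ge0_fin_numE// (le_lt_trans pc) ?ltry.
apply: (le_trans pc); rewrite lee_fin ler_pdivrMr ?exprn_gt0//.
apply: (@le_trans _ _ ((e * Num.sqrt d) ^+ 2)).
  by rewrite lerXn2r ?nnegrE// ltW.
by rewrite exprMn sqr_sqrtr ?(ltW d0)// mulrC.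
Qed.

Context (c0 a0 : R) (c0_gt0 : 0 < c0) (a0_ge0 : 0 <= a0).
Context (band_le : forall (a : R) (b : \bar R) (x y : 'rV[R]_k),
  a0 <= a -> (a%:E < b)%E -> T x -> T y ->
  (L2norm P (fun w => (W (ico a b) x w - v x w
                        - W (ico a b) y w + v y w)%R)
   <= c0%:E * ((\sum_(j < k) a `^ gamma j * `|x 0 j - y 0 j|)%R%:E + b^-1))%E).

Let weight (a : R) : R := \sum_(j < k) a `^ gamma j.

Let weight_ge0 a : 0 <= weight a.
Proof. by apply: sumr_ge0 => j _; exact: powR_ge0. Qed.

Let weight_le (a : R) (x y : 'rV[R]_k) :
  \sum_(j < k) a `^ gamma j * `|x 0 j - y 0 j| <= weight a * l1dist x y.
Proof.
rewrite mulr_suml; apply: ler_sum => j _.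
by rewrite ler_wpM2l ?powR_ge0// l1dist_coord.
Qed.

(** For [x] in [T] this is almost surely [low_frequency n x]; as a difference it
    decomposes the field at every outcome. *)
Definition low_part n (x : 'rV[R]_k) (w : Omega) : R :=
  v x w - high_frequency n x w.

Lemma measurable_low_part n x : measurable_fun setT (low_part n x).
Proof. exact: measurable_funB. Qed.

Let low_part_L2 n x y : a0 <= n%:R -> T x -> T y ->
  (L2norm P (fun w => (low_part n x w - low_part n y w)%R)
   <= (c0 * weight n%:R * l1dist x y)%:E)%E.
Proof.
move=> an Tx Ty; rewrite -(L2normN P).
have := band_le an (ltry _) Tx Ty; rewrite invey adde0 -EFinM.
rewrite (_ : (fun w => W (ico n%:R +oo%E) x w - _ - _ + _) =
  (fun w => - (low_part n x w - low_part n y w))); last first.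
  by apply/funext => w; rewrite /low_part /high_frequency; ring.
move=> /le_trans; apply; rewrite lee_fin -mulrA ler_pM2l//.
Qed.

Lemma low_part_gaussian n x y : T x -> T y ->
  centered_gaussian P (fun w => low_part n x w - low_part n y w).
Proof.
move=> Tx Ty.
pose t (i : 'I_4) : set R * 'rV[R]_k :=
  nth (set0, 0) [:: (@nonneg R, x); (ico n%:R +oo%E, x);
                   (@nonneg R, y); (ico n%:R +oo%E, y)] i.
pose c (i : 'I_4) : R := nth 0 [:: 1; -1; -1; 1] i.
have tP i : [set p : set R * 'rV[R]_k | borel_nonneg p.1 /\ T p.2] (t i).
  have bn := @borel_nonneg_nonneg R.
  have bi := @borel_nonneg_ico R n%:R +oo%E (ler0n _ _).
  by case: i => -[|[|[|[|]]]].
have := W_gaussian c tP.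
apply: centered_gaussian_ae.
- by apply: measurable_sum => i; apply: measurable_funM.
- by apply: measurable_funB; exact: measurable_low_part.
apply: filterS2 (W_total Tx) (W_total Ty) => w hx hy.
rewrite !big_ord_recl big_ord0 /t /c /= /low_part /high_frequency hx hy.
by ring.
Qed.

(** The band bound for the half-line from [n] says that the low part is
    Lipschitz in L2, and its increments are Gaussian. *)
Lemma low_part_tail n : a0 <= n%:R -> exists2 K : R, 0 < K &
  forall x y (c t : R), T x -> T y -> 0 < c -> 0 < t -> l1dist x y <= c ->
    (P [set w | (t <= `|low_part n x w - low_part n y w|)%R]
     <= (2 * expR (- (t / (K * c)) ^+ 2))%:E)%E.
Proof.
move=> an; have C0 : 0 < c0 * weight n%:R + 1.
  by rewrite ltr_wpDl// mulr_ge0// ltW.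
exists (6 * (c0 * weight n%:R + 1)); first by rewrite mulr_gt0.
move=> x y c t Tx Ty c_gt0 t0 xyc; rewrite -mulrA.
apply: gaussian_tail => //.
- exact: low_part_gaussian.
- by apply: measurable_funB; exact: measurable_low_part.
- apply: (le_trans (low_part_L2 an Tx Ty)); rewrite lee_fin.
  apply: ler_pM => //; rewrite ?l1dist_ge0 ?mulr_ge0 ?(ltW c0_gt0)//.
  by rewrite lerDl.
- by rewrite mulr_gt0.
Qed.

Context (start_le : forall x y : 'rV[R]_k, T x -> T y ->
  (L2norm P (fun w => (W (ico 0 a0%:E) x w - W (ico 0 a0%:E) y w)%R)
   <= (c0 * \sum_(j < k) `|x 0 j - y 0 j|)%R%:E)%E).

(** Continuity of the field in L2. The low part below [n] is Lipschitz, with a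
    constant that grows with [n]; the high part is the field minus the bands
    below [a0] and from [a0] to [n], and the bound for the latter leaves the
    remainder [c0 / n]. *)
Lemma field_L2_le n x y : a0 < n%:R -> T x -> T y ->
  (L2norm P (fun w => (v x w - v y w)%R)
   <= (c0 * (weight n%:R + weight a0 + 1) * l1dist x y + c0 / n%:R)%:E)%E.
Proof.
move=> an Tx Ty.
have n0 : 0 < n%:R :> R by exact: le_lt_trans an.
set H := fun w => high_frequency n x w - high_frequency n y w.
have mH : measurable_fun setT H by exact: measurable_funB.
set B := fun w => W (ico a0 n%:R%:E) x w - v x w - W (ico a0 n%:R%:E) y w + v y
    w.
set S := fun w => W (ico 0 a0%:E) x w - W (ico 0 a0%:E) y w.
have mB : measurable_fun setT B.
  by apply: measurable_funD => //; apply: measurable_funB => //; exact: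
      measurable_funB.
have mS : measurable_fun setT S by exact: measurable_funB.
have HE : L2norm P H = L2norm P (fun w => B w + S w).
  rewrite -(L2normN P H); apply: L2norm_ae.
  - exact: measurableT_comp.
  - exact: measurable_funD.
  have split z : T z -> {ae P, forall w, v z w = W (ico 0 a0%:E) z w +
      (W (ico a0 n%:R%:E) z w + high_frequency n z w)}.
    move=> Tz; have sz := W_scattered Tz.
    have h1 := scattered_ico sz (lexx 0) a0_ge0 (leey a0%:E).
    have h2 := scattered_ico sz a0_ge0 (ltW an) (leey n%:R%:E).
    apply: filterS3 (W_total Tz) h1 h2 => w <-.
    by rewrite nonneg_ico => -> ->.
  apply: filterS2 (split x Tx) (split y Ty) => w hx hy.
  by rewrite /H /B /S hx hy; ring.
have -> : (fun w => v x w - v y w) =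
    (fun w => (low_part n x w - low_part n y w) + H w).
  by apply/funext => w; rewrite /low_part /H; ring.
have mL : measurable_fun setT (fun w => low_part n x w - low_part n y w).
  by apply: measurable_funB; exact: measurable_low_part.
apply: (le_trans (L2normD P mL mH)); rewrite HE.
apply: (le_trans (leeD (low_part_L2 (ltW an) Tx Ty) (L2normD P mB mS))).
have hB := band_le (lexx a0) (_ : a0%:E < n%:R%:E)%E Tx Ty.
rewrite lte_fin in hB; have {hB} := hB an.
rewrite inver gt_eqF// -EFinD -EFinM => hB.
apply: (le_trans (leeD (le_refl _) (leeD hB (start_le Tx Ty)))).
rewrite -!EFinD lee_fin -/(l1dist x y).
have := weight_le a0 x y; rewrite -(ler_pM2l c0_gt0).
lra.
Qed.

End frequency_split.

(** * Constancy of the limits *)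

Section tail_functionals.
Context (dsp : measure_display) (Omega : measurableType dsp) (R : realType)
  (P : probability Omega R) (k : nat) (v : 'rV[R]_k -> {RV P >-> R}).
Context (v_continuous : {ae P, forall w, continuous (fun x :
    'rV[R]_k => v x w)}).
Context (lo hi x0 : 'rV[R]_k) (lo_lt_hi : forall j, lo 0 j < hi 0 j)
  (k_ge1 : (1 <= k)%N) (N : nat -> seq 'rV[R]_k).
Let T := rectangle lo hi.
Let D := net_points N.
Context (Tx0 : T x0) (netN : chaining_nets T N) (Dx0 : D x0).
Context (Y Z : nat -> 'rV[R]_k -> {RV P >-> R})
  (YZ : forall n, independent_processes T (Y n) (Z n))
  (Yv : forall x (e : R), T x -> 0 < e ->
    P [set w | e <= `|Y n x w - v x w|] @[n --> \oo] --> 0%E)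
  (vZ : forall (b : R) n, 0 < b < 1 ->
    {ae P, forall w, locally_hoelder D b (fun x => v x w - Z n x w)}).

Let DT : D `<=` T.
Proof. by move=> x [n xn]; have [+ _ _ _] := netN; apply; exact: xn. Qed.

(** The field differs from its high frequencies by a Hoelder path, so a
    functional that does not see such perturbations takes the same value along
    both, and the zero-one law applies. *)
Lemma hoelder_invariant_constant (b : R) (G : ('rV[R]_k -> R) -> \bar R) :
  0 < b < 1 ->
  measurable_fun [set: path_space R T] (G : path_space R T -> \bar R) ->
  (forall f g, locally_hoelder D b (fun x => f x - g x) -> (G f <= G g)%E) ->
  exists kappa : \bar R, {ae P, forall w, G (fun x => v x w) = kappa}.
Proof.
move=> b01 mG Gle; apply: (zero_one_constant YZ Yv mG) => n.
apply: filterS (vZ n b01) => w vZw; apply/eqP; rewrite eq_le.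
apply/andP; split; first exact: Gle.
apply: Gle; have [C [d [d0 CP]]] := vZw; exists C, d; split=> // x y Dx Dy xy.
rewrite -normrN; apply: le_trans (CP x y Dx Dy xy).
by rewrite le_eqVlt; apply/orP; left; apply/eqP; congr `|_|; rewrite /path_of;
    ring.
Qed.

Section modulus.
Context (m : 'rV[R]_k -> 'rV[R]_k -> R) (psi : R -> R).
Context (m_ge0 : forall x y, 0 <= m x y) (mC : forall x y, m x y = m y x)
  (m_triangle : forall x y z, T x -> T y -> T z -> m x z <= m x y + m y z)
  (m_small : forall (u : nat -> 'rV[R]_k) x, (forall n, T (u n)) -> T x ->
    l1dist (u n) x @[n --> \oo] --> 0 -> m (u n) x @[n --> \oo] --> 0).
Context (C g r : R) (C_ge0 : 0 <= C) (g_gt0 : 0 < g) (r_gt0 : 0 < r)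
  (l1dist_le : forall x y, T x -> T y -> m x y < r ->
    l1dist x y <= C * m x y `^ (1 + g)).
Context (psi_ge : forall t, 0 < t < loglog_scale R -> t <= psi t)
  (psi_cvg : forall t, 0 < t < loglog_scale R -> psi x @[x --> t] --> psi t).
Context (S : set ('rV[R]_k * 'rV[R]_k))
  (ST : forall p, S p -> T p.1 /\ T p.2)
  (S_x0 : forall x, T x -> S (x, x0))
  (S_dense : forall p, S p -> exists u, [/\ forall n,
      S (u n) /\ D (u n).1 /\ D (u n).2,
      l1dist (u n).1 p.1 @[n --> \oo] --> 0 &
      l1dist (u n).2 p.2 @[n --> \oo] --> 0]).

Let SD := [set p | S p /\ D p.1 /\ D p.2].

Let m_gt0 x y : T x -> T y -> x != y -> 0 < m x y.
Proof.
move=> Tx Ty xy; rewrite lt_def m_ge0 andbT; apply/eqP => m0.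
have := l1dist_le Tx Ty; rewrite m0 => /(_ r_gt0).
rewrite powR0 ?gt_eqF ?addr_gt0// mulr0 => l0.
by move/eqP: xy; apply; apply: l1dist_eq0; apply/eqP;
    rewrite eq_le l0 l1dist_ge0.
Qed.

(** Pairs at arbitrarily small positive distance exist, so that no supremum in
    the modulus is over the empty set. *)
Let near_x0 (e : R) : 0 < e -> exists p, SD p /\ 0 < m p.1 p.2 < e.
Proof.
move=> e0.
have [z Tz zx0] : exists2 z, T z & z != x0.
  have [lox0|lox0] := eqVneq lo x0.
    exists hi; first by move=> j; rewrite lexx ltW.
    rewrite -lox0; apply/eqP => hl; have := lo_lt_hi (Ordinal k_ge1).
    by rewrite hl ltxx.
  by exists lo => // j; rewrite lexx ltW.
pose y n : 'rV[R]_k := \row_j (x0 0 j + n.+1%:R^-1 * (z 0 j - x0 0 j)).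
have Ty n : T (y n).
  by apply: rectangle_segment; rewrite // invr_ge0 ler0n invf_le1// ler1n.
have yx0 n : y n != x0.
  apply: contra zx0 => /eqP/rowP yx; apply/eqP/rowP => j.
  have := yx j; rewrite mxE => /eqP; rewrite -subr_eq0 addrAC subrr add0r.
  by rewrite mulf_eq0 invr_eq0 pnatr_eq0 /= subr_eq0 => /eqP.
have yl : l1dist (y n) x0 @[n --> \oo] --> 0.
  have -> : (fun n => l1dist (y n) x0) = (fun n => l1dist z x0 * n.+1%:R^-1).
    apply/funext => n; rewrite /l1dist mulr_suml; apply: eq_bigr => j _.
    have n0 : 0 <= n.+1%:R^-1 :> R by rewrite invr_ge0.
    rewrite mxE -[X in _ = _ * X]ger0_norm// -normrM; congr `|_|; ring.
  rewrite -[X in _ --> X](mulr0 (l1dist z x0)).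
  by apply: cvgM; [exact: cvg_cst|exact: cvg_harmonic].
have [n _ /(_ n (leqnn n)) yne] := cvgr_lt _ (m_small Ty Tx0 yl) _ e0.
have [u [Du ul]] := net_dense netN (Ty n).
have Tu i : T (u i) by apply: DT; exact: Du.
have x0l : l1dist x0 x0 @[i --> \oo] --> 0.
  by rewrite l1distxx; exact: cvg_cst.
have mu := pseudometric_cvg mC m_triangle m_small Tu (fun=> Tx0) (Ty n) Tx0 ul
    x0l.
have mu0 : \forall i \near \oo, 0 < m (u i) x0.
  by apply: (cvgr_gt _ mu); exact: m_gt0.
have mue : \forall i \near \oo, m (u i) x0 < e by apply: (cvgr_lt _ mu).
have [i [i0 ie]] := filter_ex (filterI mu0 mue).
exists (u i, x0); split; last by rewrite /= i0.
by split; [apply: S_x0; exact: Tu|split; [exact: Du|exact: Dx0]].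
Qed.

Lemma modulus_constant : exists2 kappa : \bar R, (0 <= kappa)%E &
  {ae P, forall w,
    ereal_sup [set (increment_ratio m psi (fun x => v x w) p)%:E
              | p in [set p | S p /\ 0 < m p.1 p.2 <= s]] @[s --> 0^'+]
    --> kappa}.
Proof.
have psi_gt0 t : 0 < t < loglog_scale R -> 0 < psi t.
  by move=> tl; apply: lt_le_trans (psi_ge tl); case/andP: tl.
have SDS : SD `<=` S by move=> p [].
have cSD : countable SD.
  have cD := countable_net_points N.
  by apply: sub_countable (countableX cD cD); apply: subset_card_le => p [_].
set b := (1 + g / 2) / (1 + g).
have b01 : 0 < b < 1.
  by rewrite divr_gt0 ?addr_gt0 ?divr_gt0//= ltr_pdivrMr ?addr_gt0// mul1r;
      move: g_gt0; lra.
have [|f h fh|kappa kappaP] := @hoelder_invariant_constant b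
    (net_modulus m psi (loglog_scale R) SD) b01.
- exact: (measurable_net_modulus _ _ _ SDS ST cSD).
- apply: net_modulus_le => // [|e e0]; first exact: loglog_scale_gt0.
  have [C' [r' [C'0 r'0 hC]]] :=
    locally_hoelder_gain DT m_ge0 C_ge0 g_gt0 r_gt0 l1dist_le fh.
  have g20 : 0 < g / 2 by rewrite divr_gt0.
  have [s s0 sP] := powR_le_linear g20 C'0 e0.
  exists (Num.min (Num.min r' s) (loglog_scale R)).
    by rewrite !lt_min r'0 s0 loglog_scale_gt0.
  move=> p [Sp [D1 D2]]; rewrite !lt_min => /andP[m0 /andP[/andP[mr ms] ml]].
  apply: (le_trans (hC _ _ D1 D2 mr)).
  apply: (@le_trans _ _ (e * m p.1 p.2)); first by apply: sP; rewrite m0.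
  by rewrite ler_pM2l//; apply: psi_ge; rewrite m0.
have cvgm w : continuous (fun x : 'rV[R]_k => v x w) ->
    ereal_sup [set (increment_ratio m psi (fun x => v x w) p)%:E
              | p in [set p | S p /\ 0 < m p.1 p.2 <= s]] @[s --> 0^'+]
    --> net_modulus m psi (loglog_scale R) SD (fun x => v x w).
  apply: (net_modulus_cvg (T := T)) => //; first exact: loglog_scale_gt0.
  exact: pseudometric_cvg.
exists kappa.
  have [w <-] : exists w,
      net_modulus m psi (loglog_scale R) SD (fun x => v x w) = kappa.
    exact: ae_exists kappaP.
  by apply: net_modulus_ge0 => //; exact: loglog_scale_gt0.
by apply: filterS2 kappaP v_continuous => w <-; exact: cvgm.
Qed.

End modulus.

Section local_uniform.
Context (m : 'rV[R]_k -> 'rV[R]_k -> R).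
Context (m_ge0 : forall x y, 0 <= m x y) (mC : forall x y, m x y = m y x)
  (m_triangle : forall x y z, T x -> T y -> T z -> m x z <= m x y + m y z)
  (m_small : forall (u : nat -> 'rV[R]_k) x, (forall n, T (u n)) -> T x ->
    l1dist (u n) x @[n --> \oo] --> 0 -> m (u n) x @[n --> \oo] --> 0).
Context (C g r : R) (C_ge0 : 0 <= C) (g_gt0 : 0 < g) (r_gt0 : 0 < r)
  (l1dist_le : forall x y, T x -> T y -> m x y < r ->
    l1dist x y <= C * m x y `^ (1 + g)).

Lemma local_modulus_at_constant : exists2 kappa : \bar R, (0 <= kappa)%E &
  {ae P, forall w,
    local_modulus_sup m T (fun x => v x w) x0 s @[s --> 0^'+] --> kappa}.
Proof.
have [|||kappa kappa0 kappaP] := modulus_constant m_ge0 mC m_triangle m_small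
  C_ge0 g_gt0 r_gt0 l1dist_le (@lil_gauge_ge R) (@lil_gauge_cvg R)
  (S := [set p | T p.1 /\ p.2 = x0]).
- by move=> p [Tp ->].
- by [].
- move=> [x y] /= [Tx ->]; have [u [Du ux]] := net_dense netN Tx.
  exists (fun n => (u n, x0)); split=> //=.
    by move=> n; split; [split=> //; apply: DT; exact: Du|split; [exact: Du|]].
  by rewrite l1distxx; exact: cvg_cst.
exists kappa => //; apply: filterS kappaP => w.
have -> // : local_modulus_sup m T (fun x => v x w) x0 =
  (fun s => ereal_sup [set (increment_ratio m (@lil_gauge R) (fun x => v x w)
      p)%:E
     | p in [set p | (T p.1 /\ p.2 = x0) /\ 0 < m p.1 p.2 <= s]]).
apply/funext => s; congr ereal_sup.
apply/seteqP; split=> [_ [x [Tx xs] <-]|_ [[x y] /= [[Tx ->] xs] <-]].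
  by exists (x, x0).
by exists x.
Qed.

Lemma uniform_modulus_constant : exists2 kappa : \bar R, (0 <= kappa)%E &
  {ae P, forall w,
    uniform_modulus_sup m T (fun x => v x w) s @[s --> 0^'+] --> kappa}.
Proof.
have [|||kappa kappa0 kappaP] := modulus_constant m_ge0 mC m_triangle m_small
  C_ge0 g_gt0 r_gt0 l1dist_le (@uniform_gauge_ge R) (@uniform_gauge_cvg R)
  (S := [set p | T p.1 /\ T p.2]).
- by [].
- by [].
- move=> [x y] /= [Tx Ty]; have [u [Du ux]] := net_dense netN Tx.
  have [u' [Du' uy]] := net_dense netN Ty.
  exists (fun n => (u n, u' n)); split=> //=.
  move=> n; split; last by split; [exact: Du|exact: Du'].
  by split; apply: DT; [exact: Du|exact: Du'].
exists kappa => //; apply: filterS kappaP => w.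
have -> // : uniform_modulus_sup m T (fun x => v x w) =
  (fun s => ereal_sup [set (increment_ratio m (@uniform_gauge R) (fun x => v x
      w) p)%:E
     | p in [set p | (T p.1 /\ T p.2) /\ 0 < m p.1 p.2 <= s]]).
apply/funext => s; congr ereal_sup.
apply/seteqP; split=> [_ [p [Tx Ty xs] <-]|_ [p /= [[Tx Ty] xs] <-]].
  by exists p.
by exists p.
Qed.

End local_uniform.

Context (gamma : 'I_k -> R) (gamma_gt0 : forall j, 0 < gamma j).

Lemma chung_constant : exists2 kappa : \bar R, (0 <= kappa)%E &
  {ae P, forall w,
    limf_einf (chung_ratio_sup gamma T (fun x => v x w) x0) 0^'+ = kappa}.
Proof.
have Q1 := Qdim_ge1 k_ge1 gamma_gt0.
have [C [g [r [C0 g0 r0 lD]]]] := l1dist_le_Delta gamma_gt0.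
set phi := chung_gauge (Qdim gamma).
set G := net_chung x0 (fun x => Delta gamma x x0) phi (loglog_scale R) D.
set b := (1 + g / 2) / (1 + g).
have b01 : 0 < b < 1.
  by rewrite divr_gt0 ?addr_gt0 ?divr_gt0//= ltr_pdivrMr ?addr_gt0// mul1r;
      move: g0; lra.
have phi0 t : 0 < t < loglog_scale R -> 0 < phi t by exact: chung_gauge_gt0.
have mux0 : Delta gamma x0 x0 = 0 by exact: Deltaxx.
have [|f h fh|kappa kappaP] := @hoelder_invariant_constant b G b01.
- apply: measurable_net_chung => //; exact: countable_net_points.
- apply: net_chung_le => // [|e e0]; first exact: loglog_scale_gt0.
  have [C' [r' [C'0 r'0 hC]]] := locally_hoelder_gain DT
    (@Delta_ge0 _ _ gamma) C0 g0 r0 (fun x y _ _ => @lD x y) fh.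
  have g20 : 0 < g / 2 by rewrite divr_gt0.
  have [s s0 sP] := powR_le_chung_gauge Q1 g20 C'0 e0.
  exists (Num.min r' s); first by rewrite lt_min r'0.
  move=> q x /andP[q0]; rewrite lt_min => /andP[qr qs] Dx xq.
  apply: (le_trans (hC _ _ Dx Dx0 (lt_trans xq qr))).
  apply: le_trans (sP q _); last by rewrite q0.
  rewrite ler_wpM2l//; apply: ge0_ler_powR.
  - by rewrite addr_ge0// ltW.
  - by rewrite nnegrE Delta_ge0.
  - by rewrite nnegrE ltW.
  - exact: ltW.
have GE w : continuous (fun x : 'rV[R]_k => v x w) ->
    limf_einf (chung_ratio_sup gamma T (fun x => v x w) x0) 0^'+ =
    G (fun x => v x w).
  move=> cw; apply: (net_chungE (T := T)) => //.
  - exact: loglog_scale_gt0.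
  - by move=> t; exact: chung_gauge_cvg.
  - move=> f s M cf s0 fM x Tx xs.
    exact: (Delta_ball_closure gamma_gt0 Tx0 netN cf s0 fM).
exists kappa.
  have [w <-] : exists w, G (fun x => v x w) = kappa.
    exact: ae_exists kappaP.
  apply: net_chung_ge0 => //; exact: loglog_scale_gt0.
by apply: filterS2 kappaP v_continuous => w <-; exact: GE.
Qed.

End tail_functionals.

(** * The canonical metric and the three limit theorems *)

Lemma exists_nat_gt (R : realType) (x : R) : exists n : nat, x < n%:R.
Proof.
have /andP[_ xn] := truncn_itv (normr_ge0 x).
by eexists; exact: le_lt_trans (ler_norm x) xn.
Qed.

Section canonical_metric.
Context (dsp : measure_display) (Omega : measurableType dsp) (R : realType)
  (P : probability Omega R) (k : nat) (v : 'rV[R]_k -> {RV P >-> R})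
  (T : set 'rV[R]_k) (a0 c0 : R) (A : nat -> R).
Context (c0_gt0 : 0 < c0) (A_ge0 : forall n, 0 <= A n)
  (L2_le : forall n x y, a0 < n%:R -> T x -> T y ->
    (L2norm P (fun w => (v x w - v y w)%R)
     <= (A n * l1dist x y + c0 / n%:R)%:E)%E).

Let L2_fin x y : T x -> T y ->
  L2norm P (fun w => v x w - v y w) \is a fin_num.
Proof.
move=> Tx Ty; rewrite ge0_fin_numE ?L2norm_ge0//.
have [n an] := exists_nat_gt a0.
exact: le_lt_trans (L2_le an Tx Ty) (ltry _).
Qed.

Lemma canonical_metricE x y : T x -> T y ->
  (canonical_metric v x y)%:E = L2norm P (fun w => v x w - v y w).
Proof. by move=> Tx Ty; rewrite fineK// L2_fin. Qed.

Lemma canonical_metric_ge0 x y : 0 <= canonical_metric v x y.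
Proof. by rewrite fine_ge0// L2norm_ge0. Qed.

Lemma canonical_metricC x y : canonical_metric v x y = canonical_metric v y x.
Proof.
rewrite /canonical_metric -L2normN; congr (fine (L2norm _ _)).
by apply/funext => w; rewrite opprB.
Qed.

Lemma canonical_metric_triangle x y z : T x -> T y -> T z ->
  canonical_metric v x z <= canonical_metric v x y + canonical_metric v y z.
Proof.
move=> Tx Ty Tz; rewrite -lee_fin EFinD /canonical_metric !fineK ?L2_fin//.
have mxy : measurable_fun setT (fun w => v x w - v y w) by exact:
    measurable_funB.
have myz : measurable_fun setT (fun w => v y w - v z w) by exact:
    measurable_funB.
apply: le_trans (L2normD P mxy myz).
by rewrite le_eqVlt; apply/orP; left; apply/eqP; congr (L2norm _ _);
  apply/funext => w; ring.
Qed.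

Lemma canonical_metric_small (u : nat -> 'rV[R]_k) x : (forall n,
    T (u n)) -> T x ->
  l1dist (u n) x @[n --> \oo] --> 0 ->
  canonical_metric v (u n) x @[n --> \oo] --> 0.
Proof.
move=> Tu Tx ux; apply/cvgr0Pnorm_le => e e0.
have e20 : 0 < e / 2 by rewrite divr_gt0.
have [n an] := exists_nat_gt (Num.max a0 (c0 / (e / 2))).
move: an; rewrite gt_max => /andP[an cn].
have n0 : 0 < n%:R :> R by apply: le_lt_trans cn; rewrite divr_ge0// ltW.
have A1 : 0 < A n + 1 by rewrite ltr_wpDl.
have /cvgr0Pnorm_le/(_ _ (divr_gt0 e20 A1)) := ux; apply: filterS => i.
rewrite ger0_norm ?l1dist_ge0// ler_pdivlMr// => ui.
rewrite ger0_norm ?canonical_metric_ge0// -lee_fin fineK ?L2_fin//.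
apply: (le_trans (L2_le an (Tu i) Tx)); rewrite lee_fin [e]splitr.
apply: lerD.
  by apply: le_trans ui; rewrite mulrC ler_wpM2l ?l1dist_ge0// lerDl.
by rewrite ler_pdivrMr// mulrC -ler_pdivrMr// ltW.
Qed.

End canonical_metric.

Theorem lemma3p1 (dsp : measure_display) (Omega : measurableType dsp)
    (R : realType) (P : probability Omega R) (k : nat) (k_ge1 : (1 <= k)%N)
    (v : 'rV[R]_k -> {RV P >-> R})
    (v_gaussian : centered_gaussian_field [set: 'rV[R]_k] v)
    (v_continuous : {ae P, forall w, continuous (fun x : 'rV[R]_k => v x w)})
    (lo hi : 'rV[R]_k) (lo_lt_hi : forall j, lo 0 j < hi 0 j)
    (gamma : 'I_k -> R)
    (hA : assumptionA v (rectangle lo hi) gamma) :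
  [/\ chung_lil v (rectangle lo hi) gamma,
      local_modulus v (rectangle lo hi) (Delta gamma),
      uniform_modulus v (rectangle lo hi) (Delta gamma) &
      assumptionC v (rectangle lo hi) gamma ->
        local_modulus v (rectangle lo hi) (canonical_metric v) /\
        uniform_modulus v (rectangle lo hi) (canonical_metric v)].
Proof.
have [W [W_gaussian [[W_scattered W_total W_independent]
  [c0 [a0 [c0_gt0 a0_ge0 gamma_gt0 band_le start_le]]]]]] := hA.
set T := rectangle lo hi in W_gaussian W_scattered W_total W_independent
  band_le start_le *.
have [n0 an0] := exists_nat_gt a0.
(* The band bound only covers frequencies above a0. *)
pose Y n := low_frequency W (n + n0).
pose Z n := high_frequency W (n + n0).
have YZ n : independent_processes T (Y n) (Z n) by exact: low_high_independent.
have Yv x (e : R) : T x -> 0 < e ->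
    P [set w | e <= `|Y n x w - v x w|] @[n --> \oo] --> 0%E.
  move=> Tx e0; have := low_frequency_cvg W_scattered W_total Tx e0.
  by rewrite -(cvg_shiftn n0).
have an n : a0 <= (n + n0)%:R
    by rewrite (le_trans (ltW an0))// ler_nat leq_addl.
have loT : T lo by move=> j; rewrite lexx ltW.
have vZ x0 (Tx0 : T x0) (b : R) n : 0 < b < 1 -> {ae P, forall w,
    locally_hoelder (net_points (rectangle_nets lo hi x0)) b
      (fun x => v x w - Z n x w)}.
  move=> b01.
  have [K K0 tail] := low_part_tail W_gaussian W_total c0_gt0 band_le (an n).
  apply: (chaining_hoelder (chaining_rectangle_nets lo_lt_hi Tx0) K0 b01 _
      tail).
  exact: measurable_low_part.
have x0_net x0 : net_points (rectangle_nets lo hi x0) x0.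
  by exists 0%N; exact: rectangle_nets_x0.
have [C [g [r [C0 g0 r0 lD]]]] := l1dist_le_Delta gamma_gt0.
have D_small (u : nat -> 'rV[R]_k) x : (forall n, T (u n)) -> T x ->
    l1dist (u n) x @[n --> \oo] --> 0 -> Delta gamma (u n) x @[n --> \oo] --> 0.
  by move=> _ _; exact: Delta_small.
split.
- move=> x0 Tx0.
  exact: (chung_constant v_continuous k_ge1 Tx0
    (chaining_rectangle_nets lo_lt_hi Tx0) (x0_net x0) YZ Yv (vZ x0 Tx0)
        gamma_gt0).
- move=> x0 Tx0.
  exact: (local_modulus_at_constant v_continuous lo_lt_hi k_ge1 Tx0
    (chaining_rectangle_nets lo_lt_hi Tx0) (x0_net x0) YZ Yv (vZ x0 Tx0)
    (@Delta_ge0 _ _ gamma) (@DeltaC _ _ gamma)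
    (fun x y z _ _ _ => Delta_triangle gamma_gt0 x y z) D_small
    C0 g0 r0 (fun x y _ _ => @lD x y)).
- exact: (uniform_modulus_constant v_continuous lo_lt_hi k_ge1 loT
    (chaining_rectangle_nets lo_lt_hi loT) (x0_net lo) YZ Yv (vZ lo loT)
    (@Delta_ge0 _ _ gamma) (@DeltaC _ _ gamma)
    (fun x y z _ _ _ => Delta_triangle gamma_gt0 x y z) D_small
    C0 g0 r0 (fun x y _ _ => @lD x y)).
move=> [c3 c3_gt0 c3P].
pose A (n : nat) : R :=
  c0 * ((\sum_(j < k) n%:R `^ gamma j) + (\sum_(j < k) a0 `^ gamma j) + 1).
have A0 n : 0 <= A n.
  apply: mulr_ge0; first exact: ltW.
  by rewrite !addr_ge0// sumr_ge0// => j _; exact: powR_ge0.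
have L2_le n x y : a0 < n%:R -> T x -> T y ->
    (L2norm P (fun w => (v x w - v y w)%R)
     <= (A n * l1dist x y + c0 / n%:R)%:E)%E.
  move=> a_lt Tx Ty.
  exact: (field_L2_le W_scattered W_total c0_gt0 a0_ge0 band_le start_le).
have m_ge0 := canonical_metric_ge0 v.
have mC := canonical_metricC v.
have m_tri := canonical_metric_triangle L2_le.
have m_small := canonical_metric_small c0_gt0 A0 L2_le.
(* The control of the l1 distance by Delta passes to the canonical metric,
   which dominates c3 times Delta. *)
have c3r : 0 < c3 * r by rewrite mulr_gt0.
have C3 : 0 <= C * (c3^-1) `^ (1 + g) by rewrite mulr_ge0 ?powR_ge0.
have l1m x y : T x -> T y -> canonical_metric v x y < c3 * r ->
    l1dist x y <= C * (c3^-1) `^ (1 + g) * canonical_metric v x y `^ (1 + g).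
  move=> Tx Ty mr.
  have Dm : Delta gamma x y <= c3^-1 * canonical_metric v x y.
    rewrite ler_pdivlMl// -lee_fin; apply: (le_trans (c3P x y Tx Ty)).
    by rewrite (canonical_metricE L2_le).
  apply: (@le_trans _ _ (C * Delta gamma x y `^ (1 + g))).
    by apply: lD; apply: (le_lt_trans Dm); rewrite ltr_pdivrMl.
  rewrite -mulrA ler_wpM2l// -powRM ?invr_ge0 ?(ltW c3_gt0)//.
  apply: ge0_ler_powR; rewrite ?nnegrE ?Delta_ge0// ?addr_ge0 ?(ltW g0)//.
  by rewrite mulr_ge0// invr_ge0 ltW.
split.
  move=> x0 Tx0.
  exact: (local_modulus_at_constant v_continuous lo_lt_hi k_ge1 Tx0
    (chaining_rectangle_nets lo_lt_hi Tx0) (x0_net x0) YZ Yv (vZ x0 Tx0)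
    m_ge0 mC m_tri m_small C3 g0 c3r l1m).
exact: (uniform_modulus_constant v_continuous lo_lt_hi k_ge1 loT
    (chaining_rectangle_nets lo_lt_hi loT) (x0_net lo) YZ Yv (vZ lo loT)
    m_ge0 mC m_tri m_small C3 g0 c3r l1m).
Qed.
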